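(* Suppose that no algorithm solves every Dictionary Matching instance in $o(n/\sqrt{\log n})$ time. Let $P(N)$ and $Q(N)$ denote the preprocessing time and query time of any data structure for inverse suffix array queries over a binary text of length $N$. Then no such data structure can simultaneously satisfy $P(N)=o(N/\sqrt{\log N})$ and $Q(N)=o(\sqrt{\log N})$. In particular, for the data structure that, for binary texts of length $N$, uses $O(N)$ bits, has preprocessing time $O(N/\sqrt{\log N})$ and preprocessing space $O(N)$ bits, and answers inverse suffix array queries in $O(1)$ time, the $O(N/\sqrt{\log N})$ preprocessing time cannot be improved to $o(N/\sqrt{\log N})$.
   Context: Logarithms are binary; $[a..b]=\{k\in\mathbb Z:a\le k\le b\}$; strings are indexed from $1$. Dictionary Matching problem: let $n\ge2$ and $k,m\ge1$ be integers with $k=\Theta(n/\log n)$ and $m=\Theta(\log n)$. The input consists of the packed representation of a text $T\in\{0,1\}^n$ and the packed representations of a collection $\mathcal D=\{P_1,\dots,P_k\}\subseteq\{0,1\}^m$ of patterns. The output is YES if some $P_i$ occurs in $T$ as a substring, and NO otherwise. The model is the word RAM with word size $w=c\log n$, $c\ge2$ constant (standard arithmetic and bitwise word operations take $O(1)$ time). For a text $S$ of length $N$, $\mathrm{SA}_S^{-1}[j]$ ($j\in[1..N]$) is the lexicographic rank of the suffix $S[j..N]$ among all suffixes of $S$ (a proper prefix of a string is smaller than the string). A data structure for inverse suffix array queries is built by a preprocessing algorithm from the packed representation of a binary text $S$ of length $N$ in $P(N)$ time and, given $j\in[1..N]$, returns $\mathrm{SA}_S^{-1}[j]$ in $Q(N)$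 time. The packed representation of a binary string with word size $w$ stores $w$ consecutive bits per word (earlier bits in lower-order positions), with unused bits of the last word set to $0$. *)

(* Defs.v *)
From HB Require Import structures.
From mathcomp Require Import all_boot all_order all_algebra.
From mathcomp Require Import all_classical all_reals all_analysis.
Set Implicit Arguments.
Unset Strict Implicit.
Unset Printing Implicit Defensive.
Import Order.TTheory GRing.Theory Num.Theory.
Import numFieldNormedType.Exports.
Local Open Scope classical_set_scope.
Local Open Scope ring_scope.

(** * Word RAM

  A program is a fixed finite object: it uses finitely many registers, plus a
  memory whose cells are addressed by words.  Words of size w are the naturals
  below 2 ^ w.  Control flow is structured; a program with jumps becomes a
  single loop dispatching on a program counter, with O(1) overhead per step. *)

Definition register := nat.

Inductive operation :=
  | Add | Sub | Mul | Div | Mod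
  | And | Or | Xor | Shl | Shr
  | Eq | Lt.

Inductive program :=
  | Skip
  | Const of register & nat
  | Op of register & operation & register & register
  | Read of register & register    (* Read r a   is  r := memory[a] *)
  | Write of register & register   (* Write a r  is  memory[a] := r *)
  | Seq of program & program
  | If of register & program & program
  | While of register & program.

Record state := State { reg : register -> nat; mem : nat -> nat }.

Definition update (f : nat -> nat) (i v : nat) : nat -> nat :=
  fun j => if j == i then v else f j.

Definition set_reg (s : state) (r : register) (v : nat) : state :=
  State (update (reg s) r v) (mem s).

Definition set_mem (s : state) (a v : nat) : state :=
  State (reg s) (update (mem s) a v).

Definition eval_op (w : nat) (o : operation) (a b : nat) : nat :=
  (match o with
   | Add => a + b
   | Sub => a + (2 ^ w - b)      (* wraps around modulo 2 ^ w *)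
   | Mul => a * b
   | Div => a %/ b               (* 0 when b = 0 *)
   | Mod => a %% b               (* a when b = 0 *)
   | And => Nat.land a b
   | Or => Nat.lor a b
   | Xor => Nat.lxor a b
   | Shl => a * 2 ^ b
   | Shr => a %/ 2 ^ b
   | Eq => nat_of_bool (a == b)
   | Lt => nat_of_bool (a < b)
   end %% 2 ^ w)%N.

(** [exec w p s tr s']: on words of size w, program p started in state s halts
  in state s'.  The trace tr has one entry for every unit-cost step, which is
  [Some a] when the step reads or writes memory cell a and [None] otherwise. *)
Inductive exec (w : nat) : program -> state -> seq (option nat) -> state -> Prop :=
  | exec_skip s : exec w Skip s [::] s
  | exec_const s r v :
      exec w (Const r v) s [:: None] (set_reg s r (v %% 2 ^ w)%N)
  | exec_op s r o a b :
      exec w (Op r o a b) s [:: None] (set_reg s r (eval_op w o (reg s a) (reg s b)))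
  | exec_read s r a :
      exec w (Read r a) s [:: Some (reg s a)] (set_reg s r (mem s (reg s a)))
  | exec_write s a r :
      exec w (Write a r) s [:: Some (reg s a)] (set_mem s (reg s a) (reg s r))
  | exec_seq p q s s1 s2 tr1 tr2 :
      exec w p s tr1 s1 -> exec w q s1 tr2 s2 -> exec w (Seq p q) s (tr1 ++ tr2) s2
  | exec_if r p q s s' tr :
      exec w (if reg s r != 0%N then p else q) s tr s' ->
      exec w (If r p q) s (None :: tr) s'
  | exec_while_stop r p s :
      reg s r = 0%N -> exec w (While r p) s [:: None] s
  | exec_while_step r p s s1 s2 tr1 tr2 :
      reg s r != 0%N -> exec w p s tr1 s1 -> exec w (While r p) s1 tr2 s2 ->
      exec w (While r p) s (None :: tr1 ++ tr2) s2.

Definition time (tr : seq (option nat)) : nat := size tr.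

Definition cells (tr : seq (option nat)) : seq nat := undup (pmap id tr).

(** Initial state: arguments in registers 0, 1, 2, ..., input words in memory
  cells 0, 1, 2, ..., every other register and cell equal to 0. *)
Definition start (args input : seq nat) : state := State (nth 0%N args) (nth 0%N input).

Definition log2 {R : realType} (x : R) : R := ln x / ln 2.

(** Word size c log n, up to an additive constant e.  The slack covers rounding
  and the replacement of n by another length in Theta(n). *)
Definition word_size {R : realType} (c : R) (e n w : nat) : Prop :=
  `| w%:R - c * log2 n%:R | <= e%:R.

(** * Strings *)

Definition pack (w : nat) (s : seq bool) : seq nat :=
  [seq (\sum_(b < w) nth false s (i * w + b) * 2 ^ b)%N
     | i <- iota 0 ((size s + w.-1) %/ w)].

(* The suffix S[j..N], for j counted from 1. *)
Definition suffix_at (S : seq bool) (j : nat) : seqlexi bool := drop j.-1 S.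

(* Rank, counted from 1, of S[j..N] among all suffixes S[i..N], 1 <= i <= N. *)
Definition inverse_SA (S : seq bool) (j : nat) : nat :=
  (count (fun i => (suffix_at S i < suffix_at S j)%O) (iota 1 (size S))).+1.

(** * Dictionary Matching *)

(* Each pattern is packed into words of its own. *)
Definition dm_input (w n k m : nat) (T : n.-tuple bool)
    (D : k.-tuple (m.-tuple bool)) : seq nat :=
  pack w T ++ flatten [seq pack w (tval p) | p <- D].

Definition dm_answer (n k m : nat) (T : n.-tuple bool)
    (D : k.-tuple (m.-tuple bool)) : bool :=
  has (fun p : m.-tuple bool => infix p T) D.

(** On texts of length n with k n patterns of length m n, program A answers
  within t n steps.  Only n large enough matters: for the first few n the input
  may not even fit in the addressable memory. *)
Definition dm_solves {R : realType} (c : R) (A : program) (k m t : nat -> nat) : Prop :=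
  forall e : nat, \forall n \near \oo, forall w : nat, word_size c e n w ->
  forall (T : n.-tuple bool) (D : (k n).-tuple ((m n).-tuple bool)),
  exists tr s',
    [/\ exec w A (start [:: n; k n; m n; w] (dm_input w T D)) tr s',
        reg s' 0%N = nat_of_bool (dm_answer T D)
      & (time tr <= t n)%N].

(** The same program A must handle all pattern counts and pattern lengths with
  the prescribed growth, whatever the constants hidden in Theta. *)
Definition dm_fast {R : realType} (c : R) (A : program) : Prop :=
  forall k m : nat -> nat,
  (fun n => (k n)%:R : R) =Theta_\oo (fun n => n%:R / log2 n%:R : R) ->
  (fun n => (m n)%:R : R) =Theta_\oo (fun n => log2 n%:R : R) ->
  exists2 t : nat -> nat,
    (fun n => (t n)%:R : R) =o_\oo (fun n => n%:R / Num.sqrt (log2 n%:R) : R) &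
    dm_solves c A k m t.

(** * Data structures for inverse suffix array queries *)

Record isa_structure := ISAStructure { prep : program; query : program }.

Definition prep_start (w : nat) (S : seq bool) : state :=
  start [:: size S; w] (pack w S).

(* The data structure is what the preprocessing leaves in memory and registers;
   a query receives j in register 0 and may itself update the structure. *)
Definition ask (s : state) (j : nat) : state := set_reg s 0%N j.

Inductive after_queries (w : nat) (q : program) (N : nat) (s0 : state) : state -> Prop :=
  | after_prep : after_queries w q N s0 s0
  | after_query s j tr s' :
      after_queries w q N s0 s -> (1 <= j <= N)%N ->
      exec w q (ask s j) tr s' -> after_queries w q N s0 s'.

(** Preprocessing takes at most P N steps, and then every query, after any
  sequence of previous ones, is answered correctly in at most Q N steps. *)
Definition isa_solves {R : realType} (c : R) (X : isa_structure) (P Q : nat -> nat) : Prop :=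
  forall e : nat, \forall N \near \oo, forall w : nat, word_size c e N w ->
  forall S : N.-tuple bool,
  exists tr0 s0,
    [/\ exec w (prep X) (prep_start w S) tr0 s0,
        (time tr0 <= P N)%N
      & forall s j, after_queries w (query X) N s0 s -> (1 <= j <= N)%N ->
        exists tr s',
          [/\ exec w (query X) (ask s j) tr s',
              reg s' 0%N = inverse_SA S j
            & (time tr <= Q N)%N]].

(** In bits, the preprocessing touches at most PS N bits of memory, and all
  queries together stay within a set of cells of at most B N bits.  The O(1)
  registers are not counted. *)
Definition isa_space {R : realType} (c : R) (X : isa_structure) (B PS : nat -> nat) : Prop :=
  forall e : nat, \forall N \near \oo, forall w : nat, word_size c e N w ->
  forall (S : N.-tuple bool) tr0 s0, exec w (prep X) (prep_start w S) tr0 s0 ->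
  (w * size (cells tr0) <= PS N)%N /\
  exists2 C : seq nat, (w * size C <= B N)%N &
    forall s j tr s', after_queries w (query X) N s0 s -> (1 <= j <= N)%N ->
      exec w (query X) (ask s j) tr s' -> {subset cells tr <= C}.

(* Main.v *)
Require Import Defs.
From HB Require Import structures.
From mathcomp Require Import all_boot all_order all_algebra.
From mathcomp Require Import all_classical all_reals all_analysis.
From mathcomp Require Import zify ring lra.
From Stdlib Require PeanoNat.
Set Implicit Arguments.
Unset Strict Implicit.
Unset Printing Implicit Defensive.
Import Order.TTheory GRing.Theory Num.Theory.
Import numFieldNormedType.Exports.
Import Defs.
Local Open Scope classical_set_scope.
Local Open Scope nat_scope.

(** A fast inverse suffix array structure yields a fast Dictionary Matching
  algorithm.  Encode each bit b as 1 0 b.  Let U be the concatenation, over all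
  patterns P, of code(P) 0 ... 0 and code(P) 1 ... 1, and let S be
  code(T) 1 ... 1 U.  The rank of a suffix of U among the suffixes of S exceeds
  its rank among the suffixes of U by the number of smaller suffixes that start
  inside the block of T.  Hence the two rank differences for code(P) 0 ... and
  code(P) 1 ... disagree exactly when some suffix starting in the block of T lies
  between these two strings, that is, when it starts with code(P); the encoding
  can only be matched at a multiple of 3, so this means that P occurs in T.

  On the word RAM the bits are encoded by chunks of q bits through a table of
  2^q entries, with q a small constant fraction of the word size w, and S and U
  are packed into words of w' = 3hq <= w - 3 bits, where h is a constant.  The
  data structure runs on words of w' bits, which the additive slack in the word
  size allows; its two copies then fit in disjoint regions of 2^w' cells, apart
  from the input and the table. *)

(** * Values of bit strings *)

(** An inverse suffix array ranks only suffixes of its own text, so the two strings that bound the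
    suffixes starting with a pattern have to be written into that text. They then add suffixes of
    their own to every rank; the second structure, built on these strings alone, measures this
    contribution. The bits 1 0 in front of every encoded bit make room in a binary alphabet for
    paddings into which no occurrence can extend. Since km = Theta(n), both texts have length
    Theta(n). With q = Theta(log n) they are written in O(n / log n) steps, and the 4k queries,
    where k = Theta(n / log n), cost o(n / sqrt(log n)) in total as soon as one query costs
    o(sqrt(log n)). *)

Fixpoint bits_value (s : seq bool) : nat :=
  if s is b :: s' then b + 2 * bits_value s' else 0.

Lemma bits_value_cat s1 s2 :
  bits_value (s1 ++ s2) = bits_value s1 + 2 ^ size s1 * bits_value s2.
Proof. by elim: s1 => [|b s IH] /=; rewrite ?mul1n // IH expnS; nia. Qed.

Lemma bits_value_lt s : bits_value s < 2 ^ size s.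
Proof. by elim: s => //= b s IH; rewrite expnS; case: b; lia. Qed.

Lemma bits_value_take r s : bits_value (take r s) = bits_value s %% 2 ^ r.
Proof.
have [sr|rs] := leqP (size s) r.
  rewrite take_oversize // modn_small //.
  by apply: leq_trans (bits_value_lt s) _; rewrite leq_exp2l.
have tr : size (take r s) = r by rewrite size_takel // ltnW.
rewrite -[in RHS](cat_take_drop r s) bits_value_cat tr.
by rewrite addnC mulnC modnMDl ?modn_small // -[X in _ < 2 ^ X]tr bits_value_lt.
Qed.

Lemma bits_value_drop r s : bits_value (drop r s) = bits_value s %/ 2 ^ r.
Proof.
have [sr|rs] := leqP (size s) r.
  rewrite drop_oversize // divn_small //.
  by apply: leq_trans (bits_value_lt s) _; rewrite leq_exp2l.
have tr : size (take r s) = r by rewrite size_takel // ltnW.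
rewrite -[in RHS](cat_take_drop r s) bits_value_cat tr addnC mulnC.
rewrite divnMDl ?expn_gt0 // divn_small ?addn0 //.
by rewrite -[X in _ < 2 ^ X]tr bits_value_lt.
Qed.

Lemma sum_bits_value w s :
  (\sum_(b < w) nth false s b * 2 ^ b)%N = bits_value s %% 2 ^ w.
Proof.
rewrite -bits_value_take; elim: w s => [|w IH] s; first by rewrite big_ord0 take0.
rewrite big_ord_recl muln1; case: s => [|b s] /=.
  by rewrite big1 // => i _; rewrite nth_nil.
by rewrite -IH big_distrr /=; congr (_ + _); apply: eq_bigr => i _;
  rewrite /= /bump /= add1n expnS; ring.
Qed.

(** * Cells of packed strings as digits in base 2 ^ w *)

Definition word (w V a : nat) : nat := V %/ 2 ^ (a * w) %% 2 ^ w.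

Lemma word_lt w V a : word w V a < 2 ^ w.
Proof. by rewrite ltn_mod expn_gt0. Qed.

Lemma size_pack w s : size (pack w s) = (size s + w.-1) %/ w.
Proof. by rewrite size_map size_iota. Qed.

(** No bound on [a] is needed: past the end both sides are 0, so a packed string looks like the
    start of an otherwise empty memory. *)
Lemma nth_pack w s a : 0 < w -> nth 0 (pack w s) a = word w (bits_value s) a.
Proof.
move=> w0; have [ha|ha] := ltnP a ((size s + w.-1) %/ w).
  rewrite (nth_map 0) ?size_iota // nth_iota // add0n.
  rewrite /word -bits_value_drop -sum_bits_value.
  by apply: eq_bigr => i _; rewrite nth_drop.
rewrite nth_default ?size_pack // /word divn_small ?mod0n //.
apply: leq_trans (bits_value_lt s) _; rewrite leq_exp2l //.
have := leq_mul ha (leqnn w).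
have := divn_eq (size s + w.-1) w; have := ltn_mod (size s + w.-1) w; rewrite w0.
lia.
Qed.

Lemma pack_lt w s : all (fun x => x < 2 ^ w) (pack w s).
Proof.
apply/allP => x /mapP [i _ ->].
rewrite (eq_bigr (fun b : 'I_w => nth false (drop (i * w) s) b * 2 ^ b)%N).
  by rewrite sum_bits_value ltn_mod expn_gt0.
by move=> b _; rewrite nth_drop.
Qed.

(** A cell holds exactly [h] chunks of [c] bits, so a chunk never straddles two cells and appending
    it changes a single cell. This is why the simulated word size is a multiple of the chunk
    size. *)
Lemma word_append c h u x V a : 0 < h -> V < 2 ^ (c * u) -> x < 2 ^ c ->
  word (h * c) (V + x * 2 ^ (c * u)) a =
  word (h * c) V a + (if a == u %/ h then x * 2 ^ (c * (u %% h)) else 0).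
Proof.
move=> h0 Vu xc; rewrite /word.
set w := h * c; set a0 := u %/ h; set o := u %% h.
have eu : c * u = a0 * w + c * o by rewrite {1}(divn_eq u h) /w; nia.
have oh : o < h by rewrite ltn_mod.
have cw : c * o + c <= w by rewrite /w; nia.
have top : V + x * 2 ^ (c * u) < 2 ^ ((a0 * w) + w).
  apply: (@leq_trans (2 ^ (c * u + c))); last by rewrite leq_exp2l // eu; lia.
  rewrite expnD; have := expn_gt0 2 (c * u); nia.
case: (ltngtP a a0) => ha; rewrite ?addn0.
- have -> : x * 2 ^ (c * u) = (x * 2 ^ (c * u - (a * w + w)) * 2 ^ w) * 2 ^ (a * w).
    rewrite -!mulnA -!expnD; congr (_ * 2 ^ _).
    have : (a.+1 * w <= a0 * w) by rewrite leq_mul2r ha orbT.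
    by rewrite eu mulSn; lia.
  by rewrite addnC divnMDl ?expn_gt0 // modnMDl.
- have le : 2 ^ (a0 * w + w) <= 2 ^ (a * w).
    by rewrite leq_exp2l // -mulSnr leq_mul2r ha orbT.
  by rewrite !divn_small ?mod0n //; apply: leq_trans le; lia.
- subst a.
  have -> : x * 2 ^ (c * u) = (x * 2 ^ (c * o)) * 2 ^ (a0 * w).
    by rewrite -mulnA -expnD eu (addnC (c * o)).
  rewrite addnC divnMDl ?expn_gt0 //.
  have Vs : V %/ 2 ^ (a0 * w) < 2 ^ (c * o).
    by rewrite ltn_divLR ?expn_gt0 // -expnD addnC -eu.
  have cwl : 2 ^ (c * o) * 2 ^ c <= 2 ^ w by rewrite -expnD leq_exp2l.
  have sum : V %/ 2 ^ (a0 * w) + x * 2 ^ (c * o) < 2 ^ w.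
    apply: leq_trans cwl; apply: (@leq_trans (x.+1 * 2 ^ (c * o))).
      by rewrite mulSn ltn_add2r.
    by rewrite mulnC leq_mul2l xc orbT.
  by rewrite addnC !modn_small //; apply: leq_ltn_trans sum; rewrite leq_addr.
Qed.

(** Input cells need not hold a whole number of chunks, so a chunk may extend into the next cell.
    When it does not, [x1] is arbitrary, since its shifted bits vanish modulo [2 ^ r]; the next cell
    may then lie past the end of the source. *)
Lemma read_across w Y p r x1 : p < w -> r <= w ->
  r <= w - p \/ x1 = (Y %/ 2 ^ w) %% 2 ^ w ->
  ((Y %% 2 ^ w) %/ 2 ^ p + x1 * 2 ^ (w - p)) %% 2 ^ r = (Y %/ 2 ^ p) %% 2 ^ r.
Proof.
move=> pw rw H.
have e : Y %/ 2 ^ p = (Y %/ 2 ^ w) * 2 ^ (w - p) + (Y %% 2 ^ w) %/ 2 ^ p.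
  rewrite {1}(divn_eq Y (2 ^ w)).
  have -> : Y %/ 2 ^ w * 2 ^ w = (Y %/ 2 ^ w * 2 ^ (w - p)) * 2 ^ p.
    by rewrite -mulnA -expnD subnK // ltnW.
  by rewrite divnMDl ?expn_gt0.
rewrite e; case: H => [rp|->].
  have z y : y * 2 ^ (w - p) = 0 %[mod 2 ^ r].
    apply/eqP; rewrite mod0n; apply: dvdn_mull.
    by rewrite dvdn_exp2l.
  by rewrite -modnDmr z -[RHS]modnDml z !mod0n addn0 add0n.
rewrite addnC -modnDml -[RHS]modnDml; congr ((_ + _) %% _).
rewrite {2}(divn_eq (Y %/ 2 ^ w) (2 ^ w)) mulnDl -modnDml.
have -> : Y %/ 2 ^ w %/ 2 ^ w * 2 ^ w * 2 ^ (w - p) = 0 %[mod 2 ^ r].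
  by apply/eqP; rewrite mod0n mulnAC; apply: dvdn_mull; rewrite dvdn_exp2l.
by rewrite mod0n add0n.
Qed.

(** * Codes of bits and their numerical values *)

Definition encode_bit (b : bool) : seq bool := [:: true; false; b].
Definition encode (s : seq bool) : seq bool := flatten (map encode_bit s).

(** The bits as octal digits. Multiplied by 4 they land on the third bit of each triple, while
    [ones] supplies the leading bits. *)
Fixpoint spread (s : seq bool) : nat :=
  if s is b :: s' then b + 8 * spread s' else 0.

Fixpoint ones (q : nat) : nat := if q is q'.+1 then (ones q').*2.*2.*2.+1 else 0.

Lemma encode_cat s1 s2 : encode (s1 ++ s2) = encode s1 ++ encode s2.
Proof. by rewrite /encode map_cat flatten_cat. Qed.

Lemma size_encode s : size (encode s) = 3 * size s.
Proof. by elim: s => //= b s ->; lia. Qed.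

Lemma expn8 r : 8 ^ r = 2 ^ (3 * r).
Proof. by rewrite expnM. Qed.

Lemma onesE q : 8 ^ q = 7 * ones q + 1.
Proof. by elim: q => //= q IH; rewrite expnS IH; lia. Qed.

Lemma ones_div q : (8 ^ q - 1) %/ 7 = ones q.
Proof. by rewrite onesE addnK mulKn. Qed.

Lemma onesD r q : ones (r + q) = ones r + 8 ^ r * ones q.
Proof. by elim: r => [|r IH] //=; rewrite ?mul1n // IH expnS; nia. Qed.

Lemma bits_value_encode s : bits_value (encode s) = 4 * spread s + ones (size s).
Proof. by elim: s => //= b s ->; case: b; lia. Qed.

Lemma bits_value_nseq k f : bits_value (nseq k f) = if f then 2 ^ k - 1 else 0.
Proof.
by case: f; elim: k => //= k ->; rewrite ?expnS; have := expn_gt0 2 k; lia.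
Qed.

Lemma spread_lt s : 4 * spread s < 8 ^ size s.
Proof.
have := bits_value_lt (encode s); rewrite size_encode -expn8 bits_value_encode; lia.
Qed.

Definition chunk_fill (q : nat) (f : bool) : nat := if f then 8 ^ q - 1 else 0.

(** A chunk shorter than [q] needs no branch: reduction modulo [8 ^ size s] cuts off the surplus
    triples of [ones q], and dividing and multiplying the filler by the same power clears its low
    bits. *)
Lemma chunk_value q s f : size s <= q ->
  (4 * spread s + ones q) %% 8 ^ size s
    + chunk_fill q f %/ 8 ^ size s * 8 ^ size s
  = bits_value (encode s ++ nseq (3 * (q - size s)) f).
Proof.
move=> sq; rewrite bits_value_cat size_encode -expn8; congr (_ + _).
  rewrite -{1}(subnKC sq) onesD addnA -bits_value_encode addnC mulnC modnMDl.
  by rewrite modn_small // expn8 -size_encode bits_value_lt.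
rewrite bits_value_nseq /chunk_fill -expn8; case: f; last by rewrite div0n !muln0.
rewrite mulnC; congr (_ * _).
have e : 8 ^ q = 8 ^ size s * 8 ^ (q - size s) by rewrite -expnD subnKC.
have p1 := expn_gt0 8 (size s); have p2 := expn_gt0 8 (q - size s).
have -> : 8 ^ q - 1 = (8 ^ (q - size s) - 1) * 8 ^ size s + (8 ^ size s - 1).
  by rewrite e; nia.
by rewrite divnMDl // [_ %/ _]divn_small ?addn0 //; lia.
Qed.

Lemma exists_bits q v : v < 2 ^ q -> exists2 b, bits_value b = v & size b = q.
Proof.
elim: q v => [|q IH] v hv; first by exists [::] => //; case: v hv.
have [|b hb sb] := IH (v %/ 2); first by rewrite ltn_divLR // mulnC -expnS.
exists (odd v :: b) => /=; rewrite ?sb // hb mulnC addnC [in RHS](divn_eq v 2).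
by rewrite modn2.
Qed.

(** * A command language and the simulation of programs *)

Inductive expr :=
  | EReg of register
  | ECst of nat
  | EOp of operation & expr & expr
  | ELoad of expr.

Inductive cmd :=
  | CSkip
  | CSet of register & expr
  | CStore of expr & expr
  | CSeq of cmd & cmd
  | CIf of register & cmd & cmd
  | CWhile of register & cmd.

Fixpoint eval (w : nat) (s : state) (e : expr) : nat :=
  match e with
  | EReg r => reg s r
  | ECst v => v %% 2 ^ w
  | EOp o a b => eval_op w o (eval w s a) (eval w s b)
  | ELoad a => mem s (eval w s a)
  end.

Fixpoint cost (e : expr) : nat :=
  match e with
  | EReg _ => 0
  | ECst _ => 1
  | EOp _ a b => cost a + cost b + 1
  | ELoad a => cost a + 1
  end.

(** Steps are counted instead of traced, since Dictionary Matching is bounded in time only. *)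
Inductive cexec (w : nat) : cmd -> state -> nat -> state -> Prop :=
  | cexec_skip s : cexec w CSkip s 0 s
  | cexec_set s r e :
      cexec w (CSet r e) s (cost e + 1) (set_reg s r (eval w s e))
  | cexec_store s a e :
      cexec w (CStore a e) s (cost a + cost e + 1) (set_mem s (eval w s a) (eval w s e))
  | cexec_seq c1 c2 s s1 s2 t1 t2 :
      cexec w c1 s t1 s1 -> cexec w c2 s1 t2 s2 -> cexec w (CSeq c1 c2) s (t1 + t2) s2
  | cexec_if r c1 c2 s s' t :
      cexec w (if reg s r != 0 then c1 else c2) s t s' ->
      cexec w (CIf r c1 c2) s t.+1 s'
  | cexec_stop r c s : reg s r = 0 -> cexec w (CWhile r c) s 1 s
  | cexec_step r c s s1 s2 t1 t2 :
      reg s r != 0 -> cexec w c s t1 s1 -> cexec w (CWhile r c) s1 t2 s2 ->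
      cexec w (CWhile r c) s (t1 + t2).+1 s2.

(* Register r of a command becomes register 2r; odd registers hold the
   intermediate values of expressions. *)
Definition target (d : nat) (e : expr) : register :=
  if e is EReg r then 2 * r else 2 * d + 1.

Fixpoint compile_expr (d : nat) (e : expr) : program :=
  match e with
  | EReg r => Skip
  | ECst v => Const (2 * d + 1) v
  | EOp o a b => Seq (compile_expr d a)
      (Seq (compile_expr d.+1 b) (Op (2 * d + 1) o (target d a) (target d.+1 b)))
  | ELoad a => Seq (compile_expr d a) (Read (2 * d + 1) (target d a))
  end.

(* Or copies a register. *)
Fixpoint compile (c : cmd) : program :=
  match c with
  | CSkip => Skip
  | CSet r e => Seq (compile_expr 0 e) (Op (2 * r) Or (target 0 e) (target 0 e))
  | CStore a e => Seq (compile_expr 0 a)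
      (Seq (compile_expr 1 e) (Write (target 0 a) (target 1 e)))
  | CSeq c1 c2 => Seq (compile c1) (compile c2)
  | CIf r c1 c2 => If (2 * r) (compile c1) (compile c2)
  | CWhile r c => While (2 * r) (compile c)
  end.

Definition represents (cs s : state) : Prop :=
  (forall r, reg s (2 * r) = reg cs r) /\ mem s = mem cs.

Definition bounded (w : nat) (s : state) : Prop :=
  (forall r, reg s r < 2 ^ w) /\ (forall a, mem s a < 2 ^ w).

Lemma eval_op_lt w o a b : eval_op w o a b < 2 ^ w.
Proof. by rewrite /eval_op ltn_mod expn_gt0. Qed.

Lemma eval_lt w s e : bounded w s -> eval w s e < 2 ^ w.
Proof.
case=> hr hm; elim: e => //= [v|o a _ b _]; first by rewrite ltn_mod expn_gt0.
exact: eval_op_lt.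
Qed.

Lemma bounded_set_reg w s r v : bounded w s -> v < 2 ^ w -> bounded w (set_reg s r v).
Proof. by case=> hr hm hv; split=> //= r'; rewrite /update; case: eqP. Qed.

Lemma bounded_set_mem w s a v : bounded w s -> v < 2 ^ w -> bounded w (set_mem s a v).
Proof. by case=> hr hm hv; split=> //= r'; rewrite /update; case: eqP. Qed.

(** The last clause protects left operands: such a value sits in the temporary of depth [d] while
    the right operand is evaluated at depth [d.+1]. *)
Lemma compile_expr_correct w cs e d s : represents cs s ->
  exists tr s', [/\ exec w (compile_expr d e) s tr s', size tr = cost e,
    represents cs s', reg s' (target d e) = eval w cs e
    & forall d', d' < d -> reg s' (2 * d' + 1) = reg s (2 * d' + 1)].
Proof.
have odd_set cs' s' x v : represents cs' s' -> represents cs' (set_reg s' (2 * x + 1) v).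
  case=> h1 h2; split=> // r /=; rewrite /update; case: eqP => //; lia.
elim: e d s => [r|v|o a IHa b IHb|a IHa] d s hs /=.
- by exists [::], s; split=> //; [exact: exec_skip|case: hs].
- exists [:: None], (set_reg s (2 * d + 1) (v %% 2 ^ w)); split=> //.
  + exact: exec_const.
  + exact: odd_set.
  + by rewrite /= /update eqxx.
  + by move=> d' h /=; rewrite /update; case: eqP => //; lia.
- have [tr1 [s1 [x1 z1 r1 v1 f1]]] := IHa d s hs.
  have [tr2 [s2 [x2 z2 r2 v2 f2]]] := IHb d.+1 s1 r1.
  exists (tr1 ++ (tr2 ++ [:: None])),
    (set_reg s2 (2 * d + 1)
       (eval_op w o (reg s2 (target d a)) (reg s2 (target d.+1 b)))); split.
  + by apply: exec_seq x1 _; apply: exec_seq x2 _; exact: exec_op.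
  + by rewrite !size_cat z1 z2 /=; lia.
  + exact: odd_set.
  + rewrite /= /update eqxx v2; congr (eval_op _ _ _ _); rewrite -v1.
    rewrite /target; case: (a) => [r|*|*|*]; try by rewrite f2.
    by rewrite (proj1 r2) (proj1 r1).
  + move=> d' h /=; rewrite /update; case: eqP => [|_]; first lia.
    by rewrite f2 ?f1 //; lia.
- have [tr1 [s1 [x1 z1 r1 v1 f1]]] := IHa d s hs.
  exists (tr1 ++ [:: Some (reg s1 (target d a))]),
    (set_reg s1 (2 * d + 1) (mem s1 (reg s1 (target d a)))); split.
  + by apply: exec_seq x1 _; exact: exec_read.
  + by rewrite size_cat z1.
  + exact: odd_set.
  + by rewrite /= /update eqxx v1 (proj2 r1).
  + move=> d' h /=; rewrite /update; case: eqP => [|_]; first lia.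
    by rewrite f1.
Qed.

(** Copying by [Or] reduces modulo [2 ^ w], so it is faithful only for values below [2 ^ w]; hence
    [bounded] is carried along. *)
Lemma compile_correct w c cs t cs' : cexec w c cs t cs' -> bounded w cs ->
  bounded w cs' /\
  forall s, represents cs s ->
    exists tr s', [/\ exec w (compile c) s tr s', size tr = t & represents cs' s'].
Proof.
elim=> {c cs t cs'} [s|s r e|s a e|c1 c2 s s1 s2 t1 t2 _ IH1 _ IH2
   |r c1 c2 s s' t _ IH|r c s h|r c s s1 s2 t1 t2 h _ IH1 _ IH2] bs /=.
- by split=> // s0 h; exists [::], s0; split=> //; exact: exec_skip.
- split; first by apply: bounded_set_reg => //; exact: eval_lt.
  move=> s0 h; have [tr [s1 [x z r1 v f]]] := compile_expr_correct w e 0 h.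
  exists (tr ++ [:: None]),
    (set_reg s1 (2 * r) (eval_op w Or (reg s1 (target 0 e)) (reg s1 (target 0 e)))).
  split; [by apply: exec_seq x _; exact: exec_op|by rewrite size_cat z|].
  case: r1 => r1 m1; split=> //= r'; rewrite /update v /eval_op PeanoNat.Nat.lor_diag.
  rewrite modn_small ?eval_lt // r1.
  by case: (eqVneq r' r) => [->|ne]; rewrite ?eqxx // eqn_mul2l (negbTE ne).
- split; first by apply: bounded_set_mem => //; exact: eval_lt.
  move=> s0 h; have [tr [s1 [x z r1 v f]]] := compile_expr_correct w a 0 h.
  have [tr' [s2 [x2 z2 r2 v2 f2]]] := compile_expr_correct w e 1 r1.
  exists (tr ++ tr' ++ [:: Some (reg s2 (target 0 a))]),
    (set_mem s2 (reg s2 (target 0 a)) (reg s2 (target 1 e))).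
  split; [by apply: exec_seq x _; apply: exec_seq x2 _; exact: exec_write|
          by rewrite !size_cat z z2 /=; lia|].
  have -> : reg s2 (target 0 a) = eval w s a.
    rewrite -v /target; case: (a) => [r|*|*|*]; try by rewrite f2.
    by rewrite (proj1 r2) (proj1 r1).
  by case: r2 => r2 m2; split=> //=; rewrite v2 m2.
- have [b1 H1] := IH1 bs; have [b2 H2] := IH2 b1; split=> // s0 h.
  have [tr1 [s1' [x1 z1 r1]]] := H1 _ h; have [tr2 [s2' [x2 z2 r2]]] := H2 _ r1.
  exists (tr1 ++ tr2), s2'; split=> //; first exact: exec_seq x1 x2.
  by rewrite size_cat z1 z2.
- have [b1 H1] := IH bs; split=> // s0 h.
  have [tr1 [s1' [x1 z1 r1]]] := H1 _ h.
  exists (None :: tr1), s1'; split=> //=; last by rewrite z1.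
  by apply: exec_if; rewrite (proj1 h); case: ifP x1.
- split=> // s0 hs; exists [:: None], s0; split=> //.
  by apply: exec_while_stop; rewrite (proj1 hs).
- have [b1 H1] := IH1 bs; have [b2 H2] := IH2 b1; split=> // s0 hs.
  have [tr1 [s1' [x1 z1 r1]]] := H1 _ hs; have [tr2 [s2' [x2 z2 r2]]] := H2 _ r1.
  exists (None :: tr1 ++ tr2), s2'; split=> //; last by rewrite /= size_cat z1 z2.
  by apply: exec_while_step x1 x2; rewrite (proj1 hs).
Qed.

(** A Hoare triple for total correctness with a clock. One halting run is enough, because
    [dm_solves] asks for no more. Postconditions nest: that of a first command can state that the
    second one runs. *)
Definition runs (w : nat) (c : cmd) (s : state) (t : nat) (Q : state -> Prop) : Prop :=
  exists t' s', [/\ cexec w c s t' s', t' <= t & Q s'].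

Lemma runs_skip w s (Q : state -> Prop) : Q s -> runs w CSkip s 0 Q.
Proof. by move=> h; exists 0, s; split=> //; exact: cexec_skip. Qed.

Lemma runs_set w r e s (Q : state -> Prop) :
  Q (set_reg s r (eval w s e)) -> runs w (CSet r e) s (cost e + 1) Q.
Proof. by move=> h; exists (cost e + 1); eexists; split; [exact: cexec_set| |]. Qed.

Lemma runs_store w a e s (Q : state -> Prop) :
  Q (set_mem s (eval w s a) (eval w s e)) ->
  runs w (CStore a e) s (cost a + cost e + 1) Q.
Proof.
by move=> h; exists (cost a + cost e + 1); eexists; split; [exact: cexec_store| |].
Qed.

Lemma runs_seq w c1 c2 s t1 t2 Q :
  runs w c1 s t1 (fun s1 => runs w c2 s1 t2 Q) -> runs w (CSeq c1 c2) s (t1 + t2) Q.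
Proof.
case=> t1' [s1 [x1 h1 [t2' [s2 [x2 h2 q]]]]].
by exists (t1' + t2'), s2; split=> //; [exact: cexec_seq x1 x2|exact: leq_add].
Qed.

Lemma runs_weaken w c s t t' (Q Q' : state -> Prop) :
  runs w c s t Q -> t <= t' -> (forall s', Q s' -> Q' s') -> runs w c s t' Q'.
Proof.
case=> t1 [s1 [x h q]] tt' QQ'; exists t1, s1; split=> //; last exact: QQ'.
exact: leq_trans tt'.
Qed.

(** The invariant is indexed by the number of iterations left, which yields termination and running
    time together. Each iteration pays one step for its test; the last 1 is the failing test. *)
Lemma runs_while w r c tb (Inv : nat -> state -> Prop) :
  (forall i s, Inv i.+1 s -> reg s r != 0 /\ runs w c s tb (Inv i)) ->
  (forall s, Inv 0 s -> reg s r = 0) ->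
  forall i s, Inv i s -> runs w (CWhile r c) s (i * tb.+1 + 1) (Inv 0).
Proof.
move=> step stop; elim=> [|i IH] s hs.
  by exists 1, s; split=> //; apply: cexec_stop; exact: stop.
have [nz [t1 [s1 [x1 h1 q1]]]] := step _ _ hs.
have [t2 [s2 [x2 h2 q2]]] := IH _ q1.
by exists (t1 + t2).+1, s2; split=> //; [exact: cexec_step x1 x2|lia].
Qed.

(* The registers named base and modulus hold the start of the memory region
   given to p and 2 ^ w', where w' is the word size on which p is simulated. *)
Fixpoint simulate (rho : register -> register) (base modulus : register)
    (p : program) : cmd :=
  let reduce e := EOp Mod e (EReg modulus) in
  let address a := EOp Add (EReg base) (EReg (rho a)) in
  match p with
  | Skip => CSkip
  | Const r v => CSet (rho r) (reduce (ECst v))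
  | Op r o a b => CSet (rho r) (reduce (EOp o (EReg (rho a)) (EReg (rho b))))
  | Read r a => CSet (rho r) (ELoad (address a))
  | Write a r => CStore (address a) (EReg (rho r))
  | Seq p q => CSeq (simulate rho base modulus p) (simulate rho base modulus q)
  | If r p q => CIf (rho r) (simulate rho base modulus p) (simulate rho base modulus q)
  | While r p => CWhile (rho r) (simulate rho base modulus p)
  end.

(** Agreement of the memories below [2 ^ w'] is enough: [bounded] registers cannot form a larger
    address. *)
Definition embeds (w' : nat) (rho : register -> register) (start_at : nat)
    (sim s : state) : Prop :=
  [/\ forall r, reg s (rho r) = reg sim r,
      forall a, a < 2 ^ w' -> mem s (start_at + a) = mem sim a
    & bounded w' sim].

Definition unchanged_outside (w' : nat) (rho : register -> register)
    (start_at : nat) (s s' : state) : Prop :=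
  (forall r, (forall r', r != rho r') -> reg s' r = reg s r) /\
  (forall a, a < start_at \/ start_at + 2 ^ w' <= a -> mem s' a = mem s a).

Lemma unchanged_outside_trans w' rho b s1 s2 s3 :
  unchanged_outside w' rho b s1 s2 -> unchanged_outside w' rho b s2 s3 ->
  unchanged_outside w' rho b s1 s3.
Proof. by move=> [h1 h2] [k1 k2]; split=> x hx; rewrite ?k1 ?k2 ?h1 ?h2. Qed.

(** Reducing the wide result gives the narrow one because [2 ^ w'] divides [2 ^ w]. Only [Sub] needs
    more: the powers of two that it adds differ by a multiple of [2 ^ w']. *)
Lemma eval_op_mod w w' o a b : w' <= w -> b < 2 ^ w' ->
  eval_op w o a b %% 2 ^ w' = eval_op w' o a b.
Proof.
move=> ww' bw; rewrite /eval_op modn_dvdm ?dvdn_exp2l //.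
have le : 2 ^ w' <= 2 ^ w by rewrite leq_exp2l.
case: o => //.
have -> : a + (2 ^ w - b) = a + (2 ^ w' - b) + (2 ^ (w - w') - 1) * 2 ^ w'.
  have e : 2 ^ w = 2 ^ (w - w') * 2 ^ w' by rewrite -expnD subnK.
  by have := expn_gt0 2 (w - w'); nia.
by rewrite addnC modnMDl.
Qed.

(** The factor 3 covers the longest translations: an operation, its reduction and the assignment, or
    an address, the access and the assignment. The strict [w' < w] makes [2 ^ w'] itself a word, and
    the bound on [start_at] keeps shifted addresses from wrapping. *)
Lemma simulate_correct w w' rho base modulus start_at p sim tr sim' :
  injective rho -> (forall r, base != rho r) -> (forall r, modulus != rho r) ->
  w' < w -> start_at + 2 ^ w' <= 2 ^ w ->
  exec w' p sim tr sim' ->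
  forall s, embeds w' rho start_at sim s ->
    reg s base = start_at -> reg s modulus = 2 ^ w' ->
  runs w (simulate rho base modulus p) s (3 * size tr)
    (fun s' => embeds w' rho start_at sim' s' /\
               unchanged_outside w' rho start_at s s').
Proof.
move=> inj_rho base_out mod_out ww' fits.
have lt_w : 2 ^ w' < 2 ^ w by rewrite ltn_exp2l.
have set_embeds sim0 s r v : embeds w' rho start_at sim0 s -> v < 2 ^ w' ->
    embeds w' rho start_at (set_reg sim0 r v) (set_reg s (rho r) v).
  case=> h1 h2 h3 hv; split=> //=; last exact: bounded_set_reg.
  by move=> r'; rewrite /update (inj_eq inj_rho) h1.
have set_out s r v : unchanged_outside w' rho start_at s (set_reg s (rho r) v).
  by split=> // r' h /=; rewrite /update (negbTE (h _)).
have reduceE x : eval_op w Mod x (2 ^ w') = x %% 2 ^ w'.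
  by rewrite /eval_op modn_small //; apply: leq_trans lt_w; rewrite ltnS ltnW // ltn_mod expn_gt0.
have addr sim0 s r : embeds w' rho start_at sim0 s -> reg s base = start_at ->
    eval w s (EOp Add (EReg base) (EReg (rho r))) = start_at + reg sim0 r.
  case=> h1 _ [h3 _] hb; rewrite /= /eval_op hb h1 modn_small //.
  by apply: leq_trans fits; rewrite ltn_add2l.
elim=> {p sim tr sim'} [s0|s0 r v|s0 r o a b|s0 r a|s0 a r
   |p q s0 s1 s2 tr1 tr2 _ IH1 _ IH2|r p q s0 s1 tr _ IH|r p s0 h0
   |r p s0 s1 s2 tr1 tr2 h0 _ IH1 _ IH2] s hs hb hm /=.
- by apply: runs_skip; split=> //; split.
- apply: runs_set; rewrite /= hm reduceE modn_dvdm ?dvdn_exp2l ?(ltnW ww') //.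
  by split=> //; apply: set_embeds => //; rewrite ltn_mod expn_gt0.
- case: (hs) => h1 h2 [h3 h4]; apply: runs_set => /=.
  rewrite hm reduceE !h1 eval_op_mod ?(ltnW ww') //.
  by split=> //; apply: set_embeds => //; exact: eval_op_lt.
- case: (hs) => h1 h2 [h3 h4]; apply: runs_set; rewrite [eval _ _ _]/=.
  rewrite -/(eval w s (EOp Add (EReg base) (EReg (rho a)))) (addr _ _ _ hs) // h2 //.
  by split=> //; apply: set_embeds.
- case: (hs) => h1 h2 [h3 h4].
  apply: (@runs_weaken _ _ _ (cost (EOp Add (EReg base) (EReg (rho a)))
    + cost (EReg (rho r)) + 1) _ _ _ _ _ (fun _ h => h)) => //.
  apply: runs_store; rewrite (addr _ _ _ hs) // /= h1; split; last first.
    split=> // x hx /=; rewrite /update; case: eqP => // ex.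
    by have := h3 a; lia.
  split=> //=; last exact: bounded_set_mem.
  by move=> x hx; rewrite /update eqn_add2l h2.
- rewrite size_cat mulnDr; apply: runs_seq.
  apply: runs_weaken (IH1 _ hs hb hm) (leqnn _) _ => s' [hs' out'].
  have [hb' hm'] : reg s' base = start_at /\ reg s' modulus = 2 ^ w'.
    by rewrite !(proj1 out').
  apply: runs_weaken (IH2 _ hs' hb' hm') (leqnn _) _ => s'' [hs'' out''].
  by split=> //; exact: unchanged_outside_trans out' out''.
- have [t1 [s' [x h q']]] := IH _ hs hb hm.
  exists t1.+1, s'; split=> //; last by lia.
  by apply: cexec_if; case: hs => -> _ _; case: ifP x.
- exists 1, s; split=> //; first by apply: cexec_stop; case: hs => ->.
- have [t1 [s' [x1 h1 [hs' out']]]] := IH1 _ hs hb hm.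
  have [hb' hm'] : reg s' base = start_at /\ reg s' modulus = 2 ^ w'.
    by rewrite !(proj1 out').
  have [t2 [s'' [x2 h2 [hs'' out'']]]] := IH2 _ hs' hb' hm'.
  exists (t1 + t2).+1, s''; split=> //.
  + by apply: cexec_step x1 x2; case: hs => ->.
  + by rewrite size_cat; lia.
  + by split=> //; exact: unchanged_outside_trans out' out''.
Qed.

(** * Encoding the text and the patterns *)

Lemma runs_time w c s t t' Q : runs w c s t Q -> t <= t' -> runs w c s t' Q.
Proof. by move=> h le; apply: runs_weaken h le _. Qed.

Lemma runs_set_seq w r e c s t (v : nat) Q : eval w s e = v ->
  runs w c (set_reg s r v) t Q -> runs w (CSeq (CSet r e) c) s (cost e + 1 + t) Q.
Proof. by move=> <- h; apply: runs_seq; apply: runs_set. Qed.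

Lemma runs_set_last w r e s (v : nat) (Q : state -> Prop) : eval w s e = v ->
  Q (set_reg s r v) -> runs w (CSet r e) s (cost e + 1) Q.
Proof. by move=> <- h; apply: runs_set. Qed.

Lemma runs_store_seq w a e c s t (x v : nat) Q : eval w s a = x -> eval w s e = v ->
  runs w c (set_mem s x v) t Q ->
  runs w (CSeq (CStore a e) c) s (cost a + cost e + 1 + t) Q.
Proof. by move=> <- <- h; apply: runs_seq; apply: runs_store. Qed.

Declare Scope expr_scope.
Delimit Scope expr_scope with E.
Bind Scope expr_scope with expr.
Notation "$ r" := (EReg r) (at level 1, r at level 0, format "$ r") : expr_scope.
Notation "# v" := (ECst v) (at level 1, v at level 0, format "# v") : expr_scope.
Notation "! a" := (ELoad a) (at level 2, right associativity) : expr_scope.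
Notation "a + b" := (EOp Add a b) : expr_scope.
Notation "a - b" := (EOp Sub a b) : expr_scope.
Notation "a * b" := (EOp Mul a b) : expr_scope.
Notation "a %/ b" := (EOp Div a b) : expr_scope.
Notation "a %% b" := (EOp Mod a b) : expr_scope.
Notation "a `<<` b" := (EOp Shl a b) (at level 45, left associativity) : expr_scope.
Notation "a `>>` b" := (EOp Shr a b) (at level 45, left associativity) : expr_scope.
Notation "a < b" := (EOp Lt a b) : expr_scope.
Notation "a == b" := (EOp Eq a b) : expr_scope.
Notation "r ::= e" := (CSet r e%E) (at level 75).
Notation "a ::=! e" := (CStore a%E e%E) (at level 75).
Notation "c1 ;; c2" := (CSeq c1 c2) (at level 78, right associativity).

(** * Word operations that do not overflow *)

Lemma addE w a b : a + b < 2 ^ w -> eval_op w Add a b = a + b.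
Proof. by move=> h; rewrite /eval_op modn_small. Qed.
Lemma subE w a b : b <= a -> a < 2 ^ w -> eval_op w Sub a b = a - b.
Proof.
move=> h aw; rewrite /eval_op.
have -> : a + (2 ^ w - b) = 1 * 2 ^ w + (a - b) by lia.
by rewrite modnMDl modn_small //; lia.
Qed.
Lemma mulE w a b : a * b < 2 ^ w -> eval_op w Mul a b = a * b.
Proof. by move=> h; rewrite /eval_op modn_small. Qed.
Lemma divE w a b : a < 2 ^ w -> eval_op w Div a b = a %/ b.
Proof. by move=> h; rewrite /eval_op modn_small // (leq_ltn_trans _ h) // leq_div. Qed.
Lemma modE w a b : a < 2 ^ w -> eval_op w Mod a b = a %% b.
Proof. by move=> h; rewrite /eval_op modn_small // (leq_ltn_trans _ h) // leq_mod. Qed.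
Lemma shlE w a b : a * 2 ^ b < 2 ^ w -> eval_op w Shl a b = a * 2 ^ b.
Proof. by move=> h; rewrite /eval_op modn_small. Qed.
Lemma ltE w a b : 0 < w -> eval_op w Lt a b = (a < b).
Proof.
move=> h; rewrite /eval_op modn_small //; apply: leq_ltn_trans (leq_b1 _) _.
by rewrite -{1}(expn0 2) ltn_exp2l.
Qed.
Lemma eqE w a b : 0 < w -> eval_op w Eq a b = (a == b).
Proof.
move=> h; rewrite /eval_op modn_small //; apply: leq_ltn_trans (leq_b1 _) _.
by rewrite -{1}(expn0 2) ltn_exp2l.
Qed.

Definition frame (X : seq register) (lo hi : nat) (s s' : state) : Prop :=
  (forall r, r \notin X -> reg s' r = reg s r) /\
  (forall a, a < lo \/ hi <= a -> mem s' a = mem s a).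

Lemma frame_trans X lo hi s1 s2 s3 :
  frame X lo hi s1 s2 -> frame X lo hi s2 s3 -> frame X lo hi s1 s3.
Proof. by move=> [h1 h2] [k1 k2]; split=> x hx; rewrite ?k1 ?k2 ?h1 ?h2. Qed.

Lemma frame_sub X lo hi X' lo' hi' s1 s2 : {subset X <= X'} -> lo' <= lo -> hi <= hi' ->
  frame X lo hi s1 s2 -> frame X' lo' hi' s1 s2.
Proof.
move=> sX l1 l2 [h1 h2]; split=> x hx; last by apply: h2; lia.
by apply: h1; apply: contra hx; exact: sX.
Qed.

Lemma frame_set X lo hi s s1 r v : r \in X ->
  frame X lo hi s s1 -> frame X lo hi s (set_reg s1 r v).
Proof.
move=> hr [h1 h2]; split=> // r' h; rewrite -h1 //= /update.
by case: eqP => // e; rewrite e hr in h.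
Qed.

Lemma frame_set_mem X lo hi s s1 a v : lo <= a < hi ->
  frame X lo hi s s1 -> frame X lo hi s (set_mem s1 a v).
Proof.
move=> hr [h1 h2]; split=> // x h; rewrite -h2 //= /update.
by case: eqP => // e; lia.
Qed.

(** Registers below 12 hold the arguments and the constants recorded in [env]; working registers
    follow, and those of the simulated machines start at 40. *)
Notation rN := 0 (only parsing).
Notation rK := 1 (only parsing).
Notation rM := 2 (only parsing).
Notation rW := 3 (only parsing).
Notation rQ := 4 (only parsing).
Notation rChunk := 5 (only parsing).
Notation rWord := 6 (only parsing).
Notation rRegion := 7 (only parsing).
Notation rRegion2 := 8 (only parsing).
Notation rTable := 9 (only parsing).
Notation rOnes := 10 (only parsing).
Notation rFull := 11 (only parsing).
Notation rFlag := 12 (only parsing).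
Notation rSrc := 13 (only parsing).
Notation rLen := 14 (only parsing).
Notation rLim := 15 (only parsing).
Notation rFill := 16 (only parsing).
Notation rDst := 17 (only parsing).
Notation rU := 18 (only parsing).
Notation rPos := 19 (only parsing).
Notation rR := 20 (only parsing).
Notation rV := 21 (only parsing).
Notation rX := 22 (only parsing).

(** Splitting off the lowest bit gives spread(v) = v mod 2 + 8 spread(v / 2), so each entry comes
    from an earlier one. Entry 0 is the initial content of memory; the loop starts at 1. *)
Definition build_table : cmd :=
  rV ::= #1;;
  rFlag ::= #1;;
  CWhile rFlag
    ($rTable + $rV ::=! ($rV %% #2) + (#8 * !($rTable + $rV %/ #2));;
     rV ::= $rV + #1;;
     rFlag ::= $rV < (#1 `<<` $rQ)).

(** Entries are indexed by values. Trailing zeros change neither the value nor [spread], so one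
    table serves chunks of every length up to [q]. *)
Definition table_at (tab q : nat) (s : state) : Prop :=
  forall b, size b <= q -> mem s (tab + bits_value b) = spread b.

Lemma build_table_correct w q s :
  0 < q -> 3 * q + 2 <= w ->
  reg s rQ = q -> reg s rTable + 2 ^ (3 * q) <= 2 ^ w -> mem s (reg s rTable) = 0 ->
  runs w build_table s (20 * 2 ^ q)
    (fun s' => table_at (reg s rTable) q s' /\
       frame [:: rV; rFlag] (reg s rTable) (reg s rTable + 2 ^ q) s s').
Proof.
move=> q0 qw hq; set tab := reg s rTable => tabw tab0.
have w0 : 0 < w by lia.
have pq : 2 ^ q * 4 <= 2 ^ (3 * q).
  by rewrite -(expnD 2 q 2) leq_exp2l //; lia.
have q8 : 2 ^ (3 * q) * 4 <= 2 ^ w by rewrite -(expnD 2 _ 2) leq_exp2l.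
have q2 : 2 <= 2 ^ q by rewrite -{1}(expn1 2) leq_exp2l.
have cst v : v < 16 -> v %% 2 ^ w = v.
  move=> hv; rewrite modn_small //; apply: leq_trans hv _.
  by rewrite (_ : 16 = 2 ^ 4) // leq_exp2l //; lia.
pose Inv i s1 := let v := 2 ^ q - i in
  [/\ i < 2 ^ q, reg s1 rV = v, reg s1 rFlag = (0 < i),
     (forall b, bits_value b < v -> size b <= q -> mem s1 (tab + bits_value b) = spread b)
   & frame [:: rV; rFlag] tab (tab + 2 ^ q) s s1].
eapply runs_time.
  apply: (runs_set_seq (v := 1)); first by rewrite /= cst.
  apply: (runs_set_seq (v := 1)); first by rewrite /= cst.
  eapply runs_weaken; first apply: (@runs_while _ _ _ _ Inv _ _ (2 ^ q - 1)).
  - move=> i s1 [iq hv hf ht hfr].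
    have hv1 : 2 ^ q - i.+1 < 2 ^ q by lia.
    have htab : reg s1 rTable = tab by rewrite (proj1 hfr).
    have hq1 : reg s1 rQ = q by rewrite (proj1 hfr).
    split; first by rewrite hf.
    set v := 2 ^ q - i.+1 in hv hv1 ht *.
    have v0 : 0 < v by rewrite /v; lia.
    have half : v %/ 2 < v by lia.
    have spread_half b : bits_value b = v -> size b <= q ->
        spread b = v %% 2 + 8 * mem s1 (tab + v %/ 2).
      case: b => [|x b] /= hb sb; first lia.
      have -> : v %/ 2 = bits_value b by rewrite -hb; case: (x); lia.
      rewrite ht ?(ltnW sb) //; last by rewrite -hb; lia.
      by rewrite -hb; case: (x); lia.
    (* Some string of at most [q] bits has value [v]; [spread_lt] for it shows that forming the new
       entry does not overflow. *)
    have [b hb sb] : exists2 b, bits_value b = v & size b <= q.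
      by have [b hb sb] := exists_bits hv1; exists b; rewrite ?sb.
    have := spread_lt b; have : 8 ^ size b <= 2 ^ (3 * q).
      by rewrite expn8 leq_exp2l //; lia.
    rewrite (spread_half b) // => l1 l2.
    apply: (runs_store_seq (x := tab + v) (v := v %% 2 + 8 * mem s1 (tab + v %/ 2))).
    + by rewrite /= htab hv addE //; lia.
    + rewrite /= htab hv !cst // divE; last lia.
      rewrite modE; last lia.
      rewrite (@addE _ tab); last lia.
      rewrite mulE; last lia.
      by rewrite addE //; lia.
    apply: (runs_set_seq (v := v.+1)); first by rewrite /= hv cst // addE; lia.
    apply: (runs_set_last (v := v.+1 < 2 ^ q)).
      by rewrite /= /update /= hq1 cst // shlE mul1n ?ltE //; lia.
    split.
    + lia.
    + by rewrite /= /update /= /v; lia.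
    + by rewrite /= /update /= /v; congr nat_of_bool; lia.
    + move=> b' hb' sb' /=; rewrite /update eqn_add2l; case: eqP => [e|ne].
        by rewrite (spread_half b').
      by apply: ht => //; move: hb' ne; rewrite /v; lia.
    + by do 2 (apply: frame_set => //); apply: frame_set_mem => //; lia.
  - by move=> s1 [].
  - split=> //; rewrite /= /update /=; try lia.
    + move=> b hb _; have b0 : bits_value b = 0 by lia.
      rewrite b0 addn0 tab0; elim: b b0 {hb} => //= x b IH b0.
      by rewrite -IH; lia.
    + by do 2 (apply: frame_set => //).
  - exact: leqnn.
  - move=> s' [_ _ _ ht hfr]; split; last by apply: hfr.
    move=> b sb; apply: ht => //; rewrite subn0.
    by apply: leq_trans (bits_value_lt b) _; rewrite leq_exp2l.
rewrite /=; lia.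
Qed.

(** Memory in units of [2 ^ (h * (3 * q))] cells: the input in unit 0, the machine for the long text
    in unit 1, the machine for the patterns alone in unit 2, the table in unit 3. *)
Record env (w q h : nat) (s : state) : Prop := Env {
  env_w : reg s rW = w;
  env_q : reg s rQ = q;
  env_chunk : reg s rChunk = 3 * q;
  env_word : reg s rWord = h * (3 * q);
  env_region : reg s rRegion = 2 ^ (h * (3 * q));
  env_region2 : reg s rRegion2 = 2 * 2 ^ (h * (3 * q));
  env_table : reg s rTable = 3 * 2 ^ (h * (3 * q));
  env_ones : reg s rOnes = ones q;
  env_full : reg s rFull = 8 ^ q - 1;
  env_table_at : table_at (3 * 2 ^ (h * (3 * q))) q s }.

Lemma env_frame w q h X lo hi s s' : 2 ^ q <= 2 ^ (h * (3 * q)) ->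
  all (fun r => 12 <= r) X -> hi <= 3 * 2 ^ (h * (3 * q)) ->
  frame X lo hi s s' -> env w q h s -> env w q h s'.
Proof.
move=> qB /allP big lo1 [fr fm] [e1 e2 e3 e4 e5 e6 e7 e8 e9 e10].
have out r : r < 12 -> reg s' r = reg s r.
  by move=> lt; apply: fr; apply/negP => /big; rewrite leqNgt lt.
split; rewrite ?out // => b sb; rewrite fm ?e10 //.
by right; apply: leq_trans lo1 _; rewrite leq_addr.
Qed.

(** Only cells that meet the string are described, for the next cell may belong to another pattern.
    In contrast, [text_at] covers a whole region, whose zeros past the text are the empty memory of
    a simulated machine. *)
Definition source_at (w src : nat) (s : state) (b : seq bool) : Prop :=
  forall a, a * w < size b -> mem s (src + a) = word w (bits_value b) a.

Definition text_at (w' dst : nat) (s : state) (S : seq bool) : Prop :=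
  forall a, a < 2 ^ w' -> mem s (dst + a) = word w' (bits_value S) a.

(** Word subtraction wraps around, so differences are multiplied by a comparison that makes them 0
    where truncated subtraction would be. Thus [rR] becomes min(q, len - pos) without a branch, also
    past the end, where the chunk is pure padding. *)
Definition encode_chunk (h : nat) : cmd :=
  rR ::= ($rPos < $rLen) * ($rLen - $rPos);;
  rR ::= $rR - ($rQ < $rR) * ($rR - $rQ);;
  rV ::= ((!($rSrc + $rPos %/ $rW) `>>` ($rPos %% $rW))
          + (!(($rSrc + $rPos %/ $rW) + #1) `<<` ($rW - $rPos %% $rW)))
         %% (#1 `<<` $rR);;
  rX ::= #1 `<<` (#3 * $rR);;
  rX ::= (#4 * !($rTable + $rV) + $rOnes) %% $rX + $rFill %/ $rX * $rX;;
  $rDst + $rU %/ #h ::=!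
    !($rDst + $rU %/ #h) + ($rX `<<` ($rChunk * ($rU %% #h)));;
  rU ::= $rU + #1;;
  rPos ::= $rPos + $rQ;;
  rFlag ::= $rPos < $rLim + #1.

Lemma mul0E w x : eval_op w Mul 0 x = 0.
Proof. by rewrite /eval_op mul0n mod0n. Qed.

Lemma mul1E w x : x < 2 ^ w -> eval_op w Mul 1 x = x.
Proof. by move=> h; rewrite /eval_op mul1n modn_small. Qed.

Definition scratch : seq register := [:: rR; rFlag; rV; rX; rU; rPos].

Lemma encode_chunk_correct w q h s bits f S src lim dst u pos :
  0 < q -> 0 < h -> h * (3 * q) + 2 <= w -> env w q h s ->
  dst + 2 ^ (h * (3 * q)) <= 3 * 2 ^ (h * (3 * q)) ->
  reg s rSrc = src -> reg s rLen = size bits -> reg s rLim = lim ->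
  reg s rFill = chunk_fill q f -> reg s rDst = dst -> reg s rU = u ->
  reg s rPos = pos -> pos <= lim -> size bits <= lim ->
  src + lim + q + 2 < 2 ^ w ->
  source_at w src s bits -> text_at (h * (3 * q)) dst s S ->
  size S = 3 * q * u -> 3 * q * u.+1 < 2 ^ (h * (3 * q)) ->
  runs w (encode_chunk h) s 80 (fun s' =>
    let b := take q (drop pos bits) in
    [/\ text_at (h * (3 * q)) dst s' (S ++ encode b ++ nseq (3 * (q - size b)) f),
        reg s' rU = u.+1, reg s' rPos = pos + q, reg s' rFlag = (pos + q <= lim)
      & frame scratch dst (dst + 2 ^ (h * (3 * q))) s s']).
Proof.
move=> q0 h0 hw E dstB hsrc hlen hlim hfill hdst hu hpos pl bl big src_ok txt szS roomS.
set w' := h * (3 * q) in hw dstB txt roomS *; set b := take q (drop pos bits).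
set len := size bits in hlen bl *; set r := minn q (len - pos).
have szb : size b = r by rewrite size_take size_drop /r -/len /minn; case: ltnP; case: ltnP; lia.
have w0 : 0 < w by lia.
have q3w : 3 * q <= w' by rewrite /w' leq_pmull.
have BW : 2 ^ w' * 4 <= 2 ^ w by rewrite -(expnD 2 _ 2) leq_exp2l.
have B8 : 8 ^ q <= 2 ^ w' by rewrite expn8 leq_exp2l.
have Bq : 2 ^ q <= 2 ^ w' by rewrite leq_exp2l //; lia.
have qB : q < 2 ^ q by exact: ltn_expl.
have wW : w < 2 ^ w by exact: ltn_expl.
have w'B : w' < 2 ^ w' by exact: ltn_expl.
have hB : h < 2 ^ w' by apply: leq_ltn_trans w'B; rewrite leq_pmulr //; lia.
have uB : u < 2 ^ w' by nia.
have B4 : 4 <= 2 ^ w' by rewrite (_ : 4 = 2 ^ 2) // leq_exp2l //; lia.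
have cst v : v < 16 -> v %% 2 ^ w = v.
  by move=> hv; rewrite modn_small //; lia.
have rq : r <= q by exact: geq_minl.
have eb : bits_value b = bits_value bits %/ 2 ^ pos %% 2 ^ r.
  rewrite -[LHS](@modn_small _ (2 ^ r)); last by rewrite -szb bits_value_lt.
  by rewrite bits_value_take bits_value_drop modn_dvdm // dvdn_exp2l.
eapply runs_time.
  apply: (runs_set_seq (v := len - pos)).
    rewrite /= hpos hlen ltE //; case: ltnP => h1.
      by rewrite subE ?mul1E; lia.
    by rewrite mul0E; lia.
  apply: (runs_set_seq (v := r)).
    rewrite /= /update /= (env_q E) ltE // /r /minn; case: ltnP => h1.
      by rewrite (@subE _ (len - pos)) ?mul1E ?subE; lia.
    by rewrite mul0E subE; lia.
  apply: (runs_set_seq (v := bits_value b)).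
    rewrite /= /update /= hsrc hpos (env_w E) !cst //.
    have pW : pos < 2 ^ w by lia.
    have dW : pos %/ w <= pos by exact: leq_div.
    have mW : pos %% w < w by rewrite ltn_mod.
    rewrite (@divE w pos) // (@modE w pos) // (@addE w src); last lia.
    rewrite (@addE w _ 1); last lia.
    rewrite (@subE w w); [|lia|lia].
    rewrite (@shlE w 1); last by rewrite mul1n ltn_exp2l //; lia.
    have rw : r <= w by lia.
    have rW : 2 ^ r <= 2 ^ w by rewrite leq_exp2l.
    rewrite mul1n eb /eval_op [LHS]modn_small; last first.
      by apply: leq_trans rW; rewrite ltn_mod expn_gt0.
    rewrite (modn_dvdm _ (dvdn_exp2l 2 rw)).
    (* Past the end nothing is known about the source cell, but then no bit of it is kept. *)
    have [r0|r0] := posnP r; first by rewrite r0 !modn1.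
    set a := pos %/ w; set p := pos %% w.
    have epos : pos = a * w + p by exact: divn_eq.
    have raw : r <= len - pos by exact: geq_minr.
    rewrite src_ok; last by rewrite -/len; lia.
    rewrite [X in (X + _) %% _]modn_small; last first.
      by apply: leq_ltn_trans (leq_div _ _) _; exact: word_lt.
    rewrite -modnDmr (modn_dvdm _ (dvdn_exp2l 2 rw)) modnDmr.
    rewrite read_across //.
      by rewrite epos expnD divnMA.
    (* Either the next cell still meets the source, or the chunk ends within the current cell. *)
    case: (ltnP (a.+1 * w) len) => ha; [right|by left; lia].
    rewrite -addnA addn1 src_ok // /word mulSn expnD.
    by rewrite mulnC divnMA.
  apply: (runs_set_seq (v := 8 ^ r)).
    rewrite /= /update /= !cst // (@mulE w 3); last lia.
    by rewrite shlE mul1n ?expn8 // ltn_exp2l //; lia.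
  have Fb : chunk_fill q f < 8 ^ q.
    by rewrite /chunk_fill; have := expn_gt0 8 q; case: (f); lia.
  have spb : 4 * spread b < 8 ^ q.
    by apply: leq_trans (spread_lt b) _; rewrite leq_exp2l // szb.
  have bB : bits_value b < 2 ^ w'.
    by apply: leq_trans (bits_value_lt b) _; rewrite leq_exp2l // szb; lia.
  set c := encode b ++ nseq (3 * (q - size b)) f.
  have szc : size c = 3 * q by rewrite size_cat size_encode size_nseq szb; lia.
  have cB : bits_value c < 8 ^ q by rewrite expn8 -szc bits_value_lt.
  have onesq := onesE q.
  apply: (runs_set_seq (v := bits_value c)).
    rewrite /= /update /= (env_table E) (env_ones E) hfill !cst // -/w'.
    rewrite (@addE w _ (bits_value b)); last lia.
    rewrite (env_table_at E) ?szb // mulE; last lia.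
    rewrite (@addE w _ (ones q)); last lia.
    rewrite modE; last lia.
    rewrite divE; last lia.
    have sbq : size b <= q by rewrite szb.
    have ec := chunk_value f sbq; rewrite -/c szb in ec.
    have le : chunk_fill q f %/ 8 ^ r * 8 ^ r <= chunk_fill q f by exact: leq_trunc_div.
    rewrite mulE; last by apply: leq_ltn_trans le _; lia.
    by rewrite addE; rewrite ec; lia.
  have uh : u %/ h <= u by exact: leq_div.
  have oh : u %% h < h by rewrite ltn_mod.
  have app a : word w' (bits_value (S ++ c)) a = word w' (bits_value S) a
      + (if a == u %/ h then bits_value c * 2 ^ (3 * q * (u %% h)) else 0).
    rewrite bits_value_cat szS mulnC word_append //; first by rewrite -szS bits_value_lt.
    by rewrite -szc bits_value_lt.
  have wl := word_lt w' (bits_value (S ++ c)) (u %/ h).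
  apply: (runs_store_seq (x := dst + u %/ h)
    (v := word w' (bits_value (S ++ c)) (u %/ h))).
  - rewrite /= /update /= hdst hu (modn_small (_ : h < 2 ^ w)) ?divE ?addE //; lia.
  - rewrite /= /update /= hdst hu (modn_small (_ : h < 2 ^ w)) ?divE ?modE
      ?(@addE w dst) //; try lia.
    rewrite (env_chunk E) txt; last lia.
    rewrite app eqxx in wl *.
    have lt3 : 3 * q * (u %% h) < w' by rewrite /w' mulnC ltn_pmul2r ?muln_gt0.
    by rewrite mulE ?shlE ?addE //; lia.
  apply: (runs_set_seq (v := u.+1)).
    by rewrite /= /update /= hu cst // addE; lia.
  apply: (runs_set_seq (v := pos + q)).
    by rewrite /= /update /= hpos (env_q E) addE; lia.
  apply: (runs_set_last (v := pos + q <= lim)).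
    by rewrite /= /update /= hlim cst // addE ?ltE // ?addn1 ?ltnS //; lia.
  split.
  - move=> a aB /=; rewrite /update eqn_add2l; case: eqP => [->//|/eqP ne].
    by rewrite app (negbTE ne) addn0 txt.
  - by rewrite /= /update.
  - by rewrite /= /update.
  - by rewrite /= /update.
  - do 3 (apply: frame_set => //); apply: frame_set_mem.
      by rewrite leq_addr ltn_add2l (leq_ltn_trans uh uB).
    by do 5 (apply: frame_set => //).
by rewrite /=; lia.
Qed.

Definition encode_block (h : nat) : cmd :=
  rPos ::= #0;; rFlag ::= #1;; CWhile rFlag (encode_chunk h).

(** For [size b <= lim] the padding is never empty, even when [q] divides [lim], and the length
    depends on [q] and [lim] only. So every block starts at a chunk boundary and all pattern blocks
    have the same size. *)
Definition padded (q lim : nat) (f : bool) (b : seq bool) : seq bool :=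
  encode b ++ nseq (3 * ((lim %/ q).+1 * q - size b)) f.

Lemma size_padded q lim f b : 0 < q -> size b <= lim ->
  size (padded q lim f b) = 3 * q * (lim %/ q).+1.
Proof.
move=> q0 bl; rewrite size_cat size_encode size_nseq.
by have := ltn_ceil lim q0; lia.
Qed.

Lemma encode_take_step q t f b : 0 < q ->
  let upto t := encode (take (t * q) b) ++ nseq (3 * (t * q - size b)) f in
  let c := take q (drop (t * q) b) in
  upto t.+1 = upto t ++ encode c ++ nseq (3 * (q - size c)) f.
Proof.
move=> q0 /=; rewrite mulSn addnC takeD encode_cat -!catA; congr (_ ++ _).
rewrite size_take size_drop; case: ltnP => h.
  rewrite subnn muln0 (_ : t * q - size b = 0) ?muln0 /=; last lia.
  by rewrite (_ : _ - _ = 0) //; lia.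
case: (leqP (size b) (t * q)) => h1.
  rewrite drop_oversize //= -nseqD; congr nseq; lia.
by rewrite (_ : t * q - size b = 0) /=; [congr (_ ++ nseq _ _)|]; lia.
Qed.

Lemma encode_block_correct w q h s bits f S src lim dst u :
  0 < q -> 0 < h -> h * (3 * q) + 2 <= w -> env w q h s ->
  2 ^ (h * (3 * q)) <= dst -> dst + 2 ^ (h * (3 * q)) <= 3 * 2 ^ (h * (3 * q)) ->
  reg s rSrc = src -> reg s rLen = size bits -> reg s rLim = lim ->
  reg s rFill = chunk_fill q f -> reg s rDst = dst -> reg s rU = u ->
  size bits <= lim -> src + lim + q + 2 < 2 ^ (h * (3 * q)) ->
  source_at w src s bits -> text_at (h * (3 * q)) dst s S ->
  size S = 3 * q * u -> 3 * q * (u + (lim %/ q).+1) < 2 ^ (h * (3 * q)) ->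
  runs w (encode_block h) s (100 * (lim %/ q).+1) (fun s' =>
    [/\ text_at (h * (3 * q)) dst s' (S ++ padded q lim f bits),
        reg s' rU = u + (lim %/ q).+1
      & frame scratch dst (dst + 2 ^ (h * (3 * q))) s s']).
Proof.
move=> q0 h0 hw E dst0 dstB hsrc hlen hlim hfill hdst hu bl big src_ok txt szS roomS.
set w' := h * (3 * q) in hw dst0 dstB big txt roomS *; set T := (lim %/ q).+1 in roomS *.
have BW : 2 ^ w' * 4 <= 2 ^ w by rewrite -(expnD 2 _ 2) leq_exp2l.
have Bq : 2 ^ q <= 2 ^ w' by rewrite leq_exp2l // /w'; nia.
have W2 : 1 < 2 ^ w by have := expn_gt0 2 w'; lia.
pose upto t := encode (take (t * q) bits) ++ nseq (3 * (t * q - size bits)) f.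
have szu t : size (upto t) = 3 * q * t.
  by rewrite size_cat size_encode size_nseq size_take; case: ltnP; lia.
pose Inv i s1 := [/\ i <= T, reg s1 rPos = (T - i) * q,
  reg s1 rFlag = (0 < i) & [/\ reg s1 rU = u + (T - i),
  text_at w' dst s1 (S ++ upto (T - i)) & frame scratch dst (dst + 2 ^ w') s s1]].
eapply runs_time.
  apply: (runs_set_seq (v := 0)); first by rewrite /= mod0n.
  apply: (runs_set_seq (v := 1)); first by rewrite /= modn_small.
  eapply runs_weaken; first apply: (@runs_while _ _ _ 80 Inv _ _ T).
  - move=> i s1 [iT hp hf [hu1 ht fr]]; split; first by rewrite hf.
    have E1 : env w q h s1 by apply: env_frame fr E.
    have [f1 f2] := fr.
    set t := T - i.+1 in hp hu1 ht *.
    have tT : t < T by rewrite /t; lia.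
    have et : T - i = t.+1 by rewrite /t; lia.
    have tq : t * q <= lim by rewrite -leq_divRL // -ltnS.
    eapply runs_weaken.
    + apply: (encode_chunk_correct (q := q) (S := S ++ upto t) (u := u + t) (pos := t * q)
        (bits := bits) (f := f) (src := src) (lim := lim) (dst := dst)) => //;
        rewrite ?f1 // -?/w'.
      * by lia.
      (* The source lies in cells below [2 ^ w'], hence below [dst], and survives the writes. *)
      * move=> a ha; rewrite f2 ?src_ok //; left.
        have aw : a <= a * w by apply: leq_pmulr; lia.
        by apply: leq_trans dst0; lia.
      * by rewrite size_cat szS szu -mulnDr.
      * by apply: leq_ltn_trans roomS; rewrite leq_mul2l; lia.
    + exact: leqnn.
    + move=> s2 [ht2 hu2 hp2 hf2 fr2]; split.
      * lia.
      * by rewrite hp2 et mulSn addnC.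
      * by rewrite hf2 addnC -mulSn -leq_divRL //; congr nat_of_bool; rewrite /T in et tT *; lia.
      * split; first by rewrite hu2 et addnS.
        - by rewrite et /upto encode_take_step // catA.
        - exact: frame_trans fr fr2.
  - by move=> s1 [].
  - split=> //; rewrite ?subnn //=; split=> //.
    + by rewrite addn0.
    + by rewrite /upto mul0n take0 /= ?muln0 cats0.
    + by do 2 (apply: frame_set => //).
  - exact: leqnn.
  - move=> s' [_ _ _ [hu' ht' fr']]; rewrite subn0 in hu' ht'; split=> //.
    rewrite /upto take_oversize // in ht'.
    by apply: leq_trans bl _; rewrite ltnW // ltn_ceil.
rewrite /=; lia.
Qed.

Notation rI := 23 (only parsing).
Notation rMore := 24 (only parsing).
Notation rCellsT := 25 (only parsing).
Notation rCells := 26 (only parsing).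

(** Patterns are packed separately right after the text, so the source starts at [rCellsT] and
    advances by whole cells, [rCells] per pattern. *)
Definition build_patterns (h : nat) : cmd :=
  rI ::= #0;;
  rSrc ::= $rCellsT;;
  rMore ::= #0 < $rK;;
  rLen ::= $rM;;
  rLim ::= $rM + $rQ;;
  CWhile rMore
    (rFill ::= #0;;
     encode_block h;;
     rFill ::= $rFull;;
     encode_block h;;
     rSrc ::= $rSrc + $rCells;;
     rI ::= $rI + #1;;
     rMore ::= $rI < $rK).

(* With lim = m + q, the ones after code(P) outnumber the at most 3q ones after
   code(T), so an occurrence at the end of T is also below code(P) 1 ... 1. *)
Definition pattern_blocks (q lim : nat) (D : seq (seq bool)) : seq bool :=
  flatten [seq padded q lim false p ++ padded q lim true p | p <- D].

Lemma size_pattern_blocks q lim D : 0 < q -> all (fun p => size p <= lim) D ->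
  size (pattern_blocks q lim D) = 3 * q * (2 * (lim %/ q).+1 * size D).
Proof.
move=> q0; elim: D => [|p D IH] /=; first by rewrite !muln0.
by case/andP=> hp hD; rewrite 2!size_cat IH // !size_padded //; lia.
Qed.

Lemma pattern_blocks_rcons q lim D p : pattern_blocks q lim (rcons D p) =
  pattern_blocks q lim D ++ padded q lim false p ++ padded q lim true p.
Proof. by rewrite /pattern_blocks map_rcons flatten_rcons. Qed.

Definition build_scratch : seq register :=
  scratch ++ [:: rFill; rSrc; rI; rMore; rLen; rLim].

Lemma build_patterns_correct w q h s D S m cT cP dst u :
  let T := ((m + q) %/ q).+1 in
  0 < q -> 0 < h -> h * (3 * q) + 2 <= w -> env w q h s ->
  2 ^ (h * (3 * q)) <= dst -> dst + 2 ^ (h * (3 * q)) <= 3 * 2 ^ (h * (3 * q)) ->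
  all (fun p => size p == m) D -> reg s rK = size D -> reg s rM = m ->
  reg s rCellsT = cT -> reg s rCells = cP -> reg s rDst = dst -> reg s rU = u ->
  cT + size D * cP + (m + q) + q + 2 < 2 ^ (h * (3 * q)) ->
  (forall i, i < size D -> source_at w (cT + i * cP) s (nth [::] D i)) ->
  text_at (h * (3 * q)) dst s S -> size S = 3 * q * u ->
  3 * q * (u + 2 * T * size D) < 2 ^ (h * (3 * q)) ->
  runs w (build_patterns h) s (250 * T * (size D).+1) (fun s' =>
    [/\ text_at (h * (3 * q)) dst s' (S ++ pattern_blocks q (m + q) D),
        reg s' rU = u + 2 * T * size D
      & frame build_scratch dst (dst + 2 ^ (h * (3 * q))) s s']).
Proof.
move=> T q0 h0 hw E dst0 dstB szD hk hm hcT hcP hdst hu big src_ok txt szS roomS.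
set w' := h * (3 * q) in hw dst0 dstB big txt roomS *.
have BW : 2 ^ w' * 4 <= 2 ^ w by rewrite -(expnD 2 _ 2) leq_exp2l.
have Bq : 2 ^ q <= 2 ^ w' by rewrite leq_exp2l // /w'; nia.
have W2 : 1 < 2 ^ w by have := expn_gt0 2 w'; lia.
have w0 : 0 < w by lia.
have B8 : 8 ^ q <= 2 ^ w' by rewrite expn8 leq_exp2l // /w' leq_pmull.
have kB : size D < 2 ^ w' by nia.
have mod0w : 0 %% 2 ^ w = 0 by exact: mod0n.
have mod1w : 1 %% 2 ^ w = 1 by rewrite modn_small.
pose Inv i s1 := let t := size D - i in [/\ i <= size D, reg s1 rI = t,
  reg s1 rMore = (0 < i),
  [/\ reg s1 rSrc = cT + t * cP, reg s1 rLen = m & reg s1 rLim = m + q]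
  & [/\ reg s1 rU = u + 2 * T * t,
        text_at w' dst s1 (S ++ pattern_blocks q (m + q) (take t D))
      & frame build_scratch dst (dst + 2 ^ w') s s1]].
eapply runs_time.
  apply: (runs_set_seq (v := 0)); first by rewrite /=.
  apply: (runs_set_seq (v := cT)); first by rewrite /= /update.
  apply: (runs_set_seq (v := 0 < size D)).
    by rewrite /= /update /= mod0w hk ltE.
  apply: (runs_set_seq (v := m)); first by rewrite /= /update.
  apply: (runs_set_seq (v := m + q)).
    by rewrite /= /update /= hm (env_q E) addE //; lia.
  (* Two blocks cost [100 * T] each; the rest pays for the bookkeeping. *)
  eapply runs_weaken; first apply: (@runs_while _ _ _ (220 * T) Inv _ _ (size D)).
  - move=> i s1 [iT hi hmore [hsrc hlen hlim] [hu1 ht fr]].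
    split; first by rewrite hmore.
    set t := size D - i.+1 in hi hsrc hu1 ht *.
    have tT : t < size D by rewrite /t; lia.
    have et : size D - i = t.+1 by rewrite /t; lia.
    set p := nth [::] D t.
    have szp : size p = m by apply/eqP; apply: (allP szD); rewrite mem_nth.
    have szS1 : size (S ++ pattern_blocks q (m + q) (take t D)) = 3 * q * (u + 2 * T * t).
      rewrite size_cat szS size_pattern_blocks //.
        by rewrite size_takel ?(ltnW tT) // -mulnDr.
      apply/allP => x /mem_take xD; rewrite (eqP (allP szD _ xD)); lia.
    have tcP : t * cP <= size D * cP by rewrite leq_mul2r (ltnW tT) orbT.
    have tcP1 : t.+1 * cP <= size D * cP by rewrite leq_mul2r tT orbT.
    have room1 : u + 2 * T * t.+1 <= u + 2 * T * size D by rewrite leq_add2l leq_mul2l tT orbT.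
    have room2 : 3 * q * (u + 2 * T * t.+1) < 2 ^ w'.
      by apply: leq_ltn_trans roomS; rewrite leq_mul2l room1 orbT.
    have src_ok1 s2 : frame build_scratch dst (dst + 2 ^ w') s s2 ->
        source_at w (cT + t * cP) s2 p.
      move=> [_ f2] a ha; rewrite f2 ?(src_ok t tT) //; left.
      have aw : a <= a * w by apply: leq_pmulr; lia.
      by apply: leq_trans dst0; lia.
    have fixed s2 : frame build_scratch dst (dst + 2 ^ w') s s2 ->
        [/\ env w q h s2, reg s2 rDst = dst, reg s2 rCells = cP & reg s2 rK = size D].
      by move=> fr2; split; [apply: env_frame fr2 E|..]; rewrite ?(proj1 fr2).
    have widen s2 s3 : frame scratch dst (dst + 2 ^ w') s2 s3 ->
        frame build_scratch dst (dst + 2 ^ w') s2 s3.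
      by apply: frame_sub => // r hr; rewrite mem_cat hr.
    eapply runs_time.
      apply: (runs_set_seq (v := 0)); first by rewrite /=.
      set s2 := set_reg s1 _ _.
      have fr2 : frame build_scratch dst (dst + 2 ^ w') s s2 by apply: frame_set.
      have [E2 d2 c2 k2] := fixed _ fr2.
      apply: runs_seq; eapply runs_weaken; first apply: (encode_block_correct (q := q)
        (bits := p) (f := false) (src := cT + t * cP) (lim := m + q) (dst := dst)
        (u := u + 2 * T * t) (S := S ++ pattern_blocks q (m + q) (take t D))) => //.
      + by rewrite szp.
      + by rewrite szp leq_addr.
      + by rewrite -/w'; lia.
      + exact: src_ok1.
      + by apply: leq_ltn_trans room2; rewrite leq_mul2l -/T; lia.
      + exact: leqnn.
      move=> s3 [ht3 hu3 fr3]; have fr3' := frame_trans fr2 (widen _ _ fr3).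
      have keep3 r : r \notin scratch -> reg s3 r = reg s2 r := proj1 fr3 r.
      have [E3 d3 c3 k3] := fixed _ fr3'.
      apply: (runs_set_seq (v := 8 ^ q - 1)); first by rewrite /= (env_full E3).
      set s4 := set_reg s3 _ _.
      have fr4 : frame build_scratch dst (dst + 2 ^ w') s s4 by apply: frame_set.
      have [E4 d4 c4 k4] := fixed _ fr4.
      apply: runs_seq; eapply runs_weaken; first apply: (encode_block_correct (q := q)
        (bits := p) (f := true) (src := cT + t * cP) (lim := m + q) (dst := dst)
        (u := u + 2 * T * t + T)
        (S := (S ++ pattern_blocks q (m + q) (take t D)) ++ padded q (m + q) false p)) => //.
      + by rewrite /= /update /= keep3.
      + by rewrite /= /update /= keep3 //= /update /= szp.
      + by rewrite /= /update /= keep3.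
      + by rewrite szp leq_addr.
      + by rewrite -/w'; lia.
      + exact: src_ok1.
      + rewrite size_cat szS1 size_padded // ?szp ?leq_addr //; lia.
      + by apply: leq_ltn_trans room2; rewrite leq_mul2l -/T; lia.
      + exact: leqnn.
      move=> s5 [ht5 hu5 fr5]; have fr5' := frame_trans fr4 (widen _ _ fr5).
      have keep5 r : r \notin rFill :: scratch -> reg s5 r = reg s1 r.
        rewrite inE negb_or => /andP [n1 n2].
        by rewrite (proj1 fr5) //= /update (negbTE n1) keep3 //= /update (negbTE n1).
      have [E5 d5 c5 k5] := fixed _ fr5'.
      apply: (runs_set_seq (v := cT + t.+1 * cP)).
        by rewrite /= keep5 // hsrc c5 addE; lia.
      apply: (runs_set_seq (v := t.+1)).
        by rewrite /= /update /= keep5 // hi mod1w addE; lia.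
      apply: (runs_set_last (v := t.+1 < size D)).
        by rewrite /= /update /= k5 ltE.
      split.
      + lia.
      + by rewrite et.
      + by rewrite /= /update /= /t; congr nat_of_bool; lia.
      + by split; rewrite /= /update /= ?et // keep5.
      + split.
        * by rewrite /= /update /= hu5 et -/T; lia.
        * rewrite et (take_nth [::]) // pattern_blocks_rcons -/p (catA S) catA.
          exact: ht5.
        * by do 3 (apply: frame_set => //).
    rewrite /= -/T; lia.
  - by move=> s1 [].
  - split=> //; rewrite ?subnn //=; split=> //.
    + by rewrite /update /= mul0n addn0.
    + by rewrite /update /= muln0 addn0.
    + by rewrite take0 cats0.
    + by do 5 (apply: frame_set => //).
  - exact: leqnn.
  - move=> s' [_ _ _ _ [hu' ht' fr']]; rewrite subn0 take_size in hu' ht'.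
    by split.
rewrite /=; have : 0 < T by []; nia.
Qed.

(** * Occurrences and ranks *)

Definition slt (x y : seq bool) : bool := ((x : seqlexi bool) < (y : seqlexi bool))%O.

Lemma slt_cons b x y : slt (b :: x) (b :: y) = slt x y.
Proof. by rewrite /slt ltxi_cons lexx. Qed.

Lemma slt_cons_neq b b' x y : b != b' -> slt (b :: x) (b' :: y) = b'.
Proof. by move=> h; rewrite /slt neqhead_ltxiE //; case: b b' h => [] []. Qed.

Lemma slt_cat p x y : slt (p ++ x) (p ++ y) = slt x y.
Proof. by elim: p => //= b p IH; rewrite slt_cons. Qed.

Lemma slt_trans x y z : slt x y -> slt y z -> slt x z.
Proof. exact: lt_trans. Qed.

(** In the lexicographic order the strings with prefix [p] form an interval. *)
Lemma prefix_between p x y z : ~~ slt z (p ++ x) -> slt z (p ++ y) -> prefix p z.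
Proof.
elim: p z => [|b p IH] [|b' z] /=; first by [].
- by [].
- by rewrite /slt ltxi0s.
- case: (eqVneq b' b) => [->|ne]; first by rewrite !slt_cons; exact: IH.
  by rewrite !slt_cons_neq //; case: (b).
Qed.

(** A suffix of [X ++ U] that starts in [U] is a suffix of [U], so the two ranks differ only by the
    smaller suffixes that start inside [X]. *)
Lemma inverse_SA_cat X U j : 0 < j ->
  inverse_SA (X ++ U) (size X + j) =
  inverse_SA U j + count (fun i => slt (drop i (X ++ U)) (drop j.-1 U)) (iota 0 (size X)).
Proof.
move=> j0; rewrite /inverse_SA size_cat iotaD count_cat.
have dU i : 0 < i -> suffix_at (X ++ U) (size X + i) = suffix_at U i.
  case: i => // i _; rewrite /suffix_at addnS /= drop_cat ltnNge leq_addr /=.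
  by rewrite addKn.
have -> : iota (1 + size X) (size U) = [seq size X + i | i <- iota 1 (size U)].
  by rewrite -iotaDl addnC.
have -> : iota 1 (size X) = [seq 1 + i | i <- iota 0 (size X)] by rewrite -iotaDl.
rewrite !count_map addSn addnC; congr (_ + _).+1.
  by apply: eq_in_count => i; rewrite mem_iota => /andP [i0 _] /=; rewrite !dU.
by apply: eq_count => i /=; rewrite dU // /slt /suffix_at add1n.
Qed.

Lemma count_diff (T : eqType) (a b : pred T) s : subpred a b ->
  (count b s != count a s) = has (predD b a) s.
Proof.
move=> ab; have -> : count b s = count a s + count (predD b a) s.
  elim: s => //= x s ->; case ax: (a x) => /=; first by rewrite (ab _ ax); lia.
  by lia.
by rewrite -[X in _ != X]addn0 eqn_add2l has_count lt0n.
Qed.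

Lemma nth_encode s j o : j < size s -> o < 3 ->
  nth false (encode s) (3 * j + o) = nth false (encode_bit (nth false s j)) o.
Proof.
elim: s j => // b s IH [|j] js o3; first by rewrite muln0; case: o o3 {IH} => [|[|[]]].
by rewrite (_ : 3 * j.+1 + o = (3 * j + o).+3); [exact: IH|lia].
Qed.

(* Every window of the encoding that begins with the bits 1 0 starts at a
   multiple of 3, and the ones that follow the encoding cannot continue it. *)
Lemma encode_synchronized (T p U : seq bool) r i :
  0 < r -> p != [::] -> nth false U 0 -> i < 3 * size T + r ->
  prefix (encode p) (drop i (encode T ++ nseq r true ++ U)) -> infix p T.
Proof.
set Y := encode T ++ _ => r0 p0 U0 iT pre.
have p1 : 0 < size p by rewrite lt0n size_eq0.
have Yin j o : j < size T -> o < 3 ->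
    nth false Y (3 * j + o) = nth false (encode_bit (nth false T j)) o.
  by move=> jT o3; rewrite nth_cat size_encode (_ : _ < _) ?nth_encode //; lia.
(* At [x = r] this is the first bit of [U]; including it rules out a code that starts at the last
   padding bit. *)
have Yout x : x <= r -> nth false Y (3 * size T + x).
  move=> xr; rewrite nth_cat size_encode ltnNge leq_addr /= addKn nth_cat size_nseq.
  case: ltnP => h; first by rewrite nth_nseq h.
  by rewrite (_ : x - r = 0) //; lia.
have win t o : t < size p -> o < 3 ->
    nth false Y (i + (3 * t + o)) = nth false (encode_bit (nth false p t)) o.
  move=> tp o3; rewrite -nth_drop -nth_encode //.
  have /prefixP [rest ->] := pre.
  by rewrite nth_cat size_encode (_ : _ < _) //; lia.
have w0 : nth false Y i by move: (win 0 0 p1 isT); rewrite muln0 !addn0 => ->.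
have w1 : nth false Y (i + 1) = false by have := win 0 1 p1 isT.
have iT3 : i < 3 * size T.
  rewrite ltnNge; apply/negP => h; move: w1.
  by rewrite (_ : i + 1 = 3 * size T + (i + 1 - 3 * size T)) ?Yout //; lia.
have ei := divn_eq i 3; set j := i %/ 3 in ei; have o3 := ltn_pmod i (isT : 0 < 3).
have jT : j < size T by lia.
(* At residue 1 the bit at [i] would be the constant 0 of a code; at residue 2 the next bit would be
   the leading 1 of another code or of the padding. *)
have o0 : i %% 3 = 0.
  case E: (i %% 3) o3 => [//|[|[|//]]] _; rewrite E in ei.
    by move: w0; rewrite ei mulnC Yin.
  move: w1; rewrite ei (_ : _ + 1 = 3 * j.+1 + 0); last lia.
  have [lt|ge] := ltnP j.+1 (size T); first by rewrite Yin.
  by rewrite (_ : j.+1 = size T) ?Yout //; lia.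
have e3 : i = 3 * j by lia.
(* The first triple outside the code of [T] would show a 1 as its middle bit. *)
have inT t : t < size p -> j + t < size T.
  elim: t => [|t IH] tp; first by rewrite addn0.
  have h := IH (ltnW tp); rewrite ltn_neqAle addnS h andbT.
  apply/eqP => e; have := win t.+1 1 tp isT.
  rewrite (_ : i + _ = 3 * size T + 1); last lia.
  by rewrite Yout.
have sz : j + size p <= size T by have := inT (size p).-1; lia.
have -> : p = take (size p) (drop j T).
  apply: (@eq_from_nth _ false); first by rewrite size_takel // size_drop; lia.
  move=> t tp; rewrite nth_take // nth_drop.
  have := win t 2 tp isT; rewrite (_ : i + _ = 3 * (j + t) + 2); last lia.
  by rewrite Yin ?inT //= => ->.
exact: infix_trans (infix_take _ _) (infix_drop _ _).
Qed.

(** At an occurrence, what follows code(p) starts with 1 and so exceeds the lower string. It starts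
    with 1 0 or, at the end of [T], with r + 1 ones and a 0, as [U] contributes a 1 of its own;
    [1 < e] gives the upper string more ones in both cases. *)
Lemma occurrence_window (T p U' lo hi : seq bool) r e :
  0 < r -> 1 < e -> p != [::] ->
  has (fun i => let z := drop i (encode T ++ nseq r true ++ true :: false :: U') in
         ~~ slt z (encode p ++ false :: lo) &&
         slt z (encode p ++ nseq (r + e) true ++ hi))
    (iota 0 (3 * size T + r)) = infix p T.
Proof.
move=> r0 e1 p0; apply/hasP/idP => [[i]|/infixP [a [b eT]]].
  rewrite mem_iota add0n => iT /andP [h1 h2].
  exact: encode_synchronized (prefix_between h1 h2).
have aT : size a <= size T by rewrite eT !size_cat leq_addr.
exists (3 * size a).
  rewrite mem_iota add0n /= (leq_ltn_trans (leq_mul (leqnn 3) aT)) //.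
  by rewrite -[X in X < _]addn0 ltn_add2l.
have -> : drop (3 * size a) (encode T ++ nseq r true ++ true :: false :: U') =
    encode p ++ encode b ++ nseq r true ++ true :: false :: U'.
  rewrite eT !encode_cat -!catA drop_cat size_encode ltnn subnn drop0 //.
rewrite /= !slt_cat; case: b {eT} => [|x b] /=.
  rewrite nseqD -catA slt_cat; case: r r0 => // r _; case: e e1 => [|[|e]] // _ /=.
by case: r r0 => // r _; case: e e1 => [|e] // _; rewrite addSn addnS /= !slt_cons !slt_cons_neq.
Qed.

Lemma drop_pattern_blocks q lim D i : 0 < q -> all (fun p => size p <= lim) D ->
  i < size D ->
  drop (3 * q * (2 * (lim %/ q).+1 * i)) (pattern_blocks q lim D) =
  padded q lim false (nth [::] D i) ++ padded q lim true (nth [::] D i) ++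
  pattern_blocks q lim (drop i.+1 D).
Proof.
move=> q0; elim: D i => // p D IH [|i] /= /andP [hp hD] iD.
  by rewrite !muln0 !drop0; symmetry; exact: catA.
have sz : size (padded q lim false p ++ padded q lim true p) =
    3 * q * (2 * (lim %/ q).+1) by rewrite size_cat !size_padded //; lia.
rewrite mulnS mulnDr -sz addnC -drop_drop drop_size_cat //; exact: IH.
Qed.

Lemma pattern_blocks_head q lim D : D != [::] -> all (fun p => 0 < size p) D ->
  exists U', pattern_blocks q lim D = true :: false :: U'.
Proof.
by case: D => // [[|b p] D] //= _ _; eexists; reflexivity.
Qed.

(** Adding the ranks in [U] crosswise turns a comparison of rank differences into one of sums, free
    of subtraction. Positions count from 1, hence the last 1 in [lo]. *)
Lemma detect_occurrence q m T D i :
  let X := padded q (size T) true T in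
  let U := pattern_blocks q (m + q) D in
  let step := 3 * q * ((m + q) %/ q).+1 in
  let lo := 2 * i * step + 1 in
  0 < q -> 0 < m -> all (fun p => size p == m) D -> i < size D ->
  (inverse_SA (X ++ U) (size X + (lo + step)) + inverse_SA U lo
   != inverse_SA (X ++ U) (size X + lo) + inverse_SA U (lo + step)) =
  infix (nth [::] D i) T.
Proof.
move=> X U step lo q0 m0 szD iD; set p := nth [::] D i.
have szp : size p = m by apply/eqP; apply: (allP szD); rewrite mem_nth.
have leD : all (fun p => size p <= m + q) D.
  by apply/allP => x xD; rewrite (eqP (allP szD _ xD)) leq_addr.
have [U' eU] : exists U', U = true :: false :: U'.
  apply: pattern_blocks_head; first by case: (D) iD.
  by apply/allP => x xD; rewrite (eqP (allP szD _ xD)).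
have := drop_pattern_blocks q0 leD iD; rewrite -/p -/U.
set rest := pattern_blocks _ _ _ => dU.
have dlo : drop lo.-1 U = padded q (m + q) false p ++ padded q (m + q) true p ++ rest.
  by rewrite -dU; congr drop; rewrite /lo /step; lia.
have dhi : drop (lo + step).-1 U = padded q (m + q) true p ++ rest.
  rewrite (_ : _.-1 = step + lo.-1); last by rewrite /lo; lia.
  rewrite -drop_drop dlo drop_size_cat // size_padded // ?szp ?leq_addr //.
set r := 3 * ((size T %/ q).+1 * q - size T).
set r' := 3 * (((m + q) %/ q).+1 * q - m).
have r0 : 0 < r by have := ltn_ceil (size T) q0; rewrite /r; lia.
(* The text has at most 3q padding bits, while the [q] added to [m] gives every pattern at least 3(q
   + 1), so the excess is at least 3. *)
have [e e1 er] : exists2 e, 1 < e & r' = r + e.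
  exists (r' - r); have := ltn_ceil (m + q) q0; have := leq_trunc_div (size T) q;
    by rewrite /r /r' mulSn; lia.
have elo : padded q (m + q) false p = encode p ++ false :: nseq r'.-1 false.
  by rewrite /padded szp -/r' er; case: (r) r0.
have ehi : padded q (m + q) true p = encode p ++ nseq (r + e) true.
  by rewrite /padded szp -/r' er.
have lo0 : 0 < lo by rewrite /lo addn1.
have lo1 : 0 < lo + step by exact: ltn_addr.
rewrite (inverse_SA_cat X U lo0) (inverse_SA_cat X U lo1).
set tail := _ ++ rest in dlo; rewrite dlo dhi elo ehi -!catA cat_cons.
set y := encode p ++ false :: _; set z := encode p ++ nseq _ true ++ _.
rewrite addnAC [in X in _ != X]addnAC [in X in _ != X](addnC (inverse_SA U lo)) eqn_add2l.
rewrite count_diff.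
  have szX : size X = 3 * size T + r by rewrite size_cat size_encode size_nseq.
  rewrite szX -(occurrence_window T U' (nseq r'.-1 false ++ tail)
    rest r0 e1 (p := p)); last by rewrite -size_eq0 szp -lt0n.
  by apply: eq_in_has => j _ /=; rewrite eU.
move=> j /= jy; apply: slt_trans jy _.
by rewrite slt_cat; case: (r) r0 => // r1 _; rewrite addSn /= slt_cons_neq.
Qed.

(** * The reduction *)

Notation rTextChunks := 27 (only parsing).
Notation rOff := 28 (only parsing).
Notation rStep := 29 (only parsing).
Notation rJ := 30 (only parsing).
Notation rAns := 31 (only parsing).
Notation rLo1 := 32 (only parsing).
Notation rLo2 := 33 (only parsing).
Notation rHi1 := 34 (only parsing).
Notation rHi2 := 35 (only parsing).

(** The programs of the structure may use any registers, so the two machines get interleaved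
    infinite families, told apart by parity. *)
Definition sim_reg (i : nat) (r : register) : register := 40 + 2 * r + i.

Lemma sim_reg_inj i : injective (sim_reg i).
Proof. by move=> x y; rewrite /sim_reg; lia. Qed.

Lemma sim_reg_big i r x : r < 40 -> r != sim_reg i x.
Proof. by rewrite /sim_reg; lia. Qed.

Lemma sim_reg_disjoint x y : sim_reg 0 x != sim_reg 1 y.
Proof. by rewrite /sim_reg; lia. Qed.

(** The decrement in [rQ] leaves at least 3h spare bits, so that eight regions of the size of a
    simulated memory are addressable; rounding alone might leave none. *)
Definition setup (h : nat) : cmd :=
  rQ ::= $rW %/ #(3 * h) - #1;;
  rChunk ::= #3 * $rQ;;
  rWord ::= #h * $rChunk;;
  rRegion ::= #1 `<<` $rWord;;
  rRegion2 ::= #2 * $rRegion;;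
  rTable ::= #3 * $rRegion;;
  rFull ::= (#1 `<<` $rChunk) - #1;;
  rOnes ::= $rFull %/ #7;;
  rCellsT ::= ($rN + ($rW - #1)) %/ $rW;;
  rCells ::= ($rM + ($rW - #1)) %/ $rW;;
  build_table.

Definition setup_scratch : seq register :=
  [:: rQ; rChunk; rWord; rRegion; rRegion2; rTable; rFull; rOnes; rCellsT; rCells;
      rV; rFlag].

Lemma chunk_size w h : let q := w %/ (3 * h) - 1 in 0 < q ->
  eval_op w Sub (eval_op w Div w (3 * h)) 1 = q /\ 3 * h * q.+1 <= w.
Proof.
move=> q; rewrite /q; have wW : w < 2 ^ w by exact: ltn_expl.
have dW := leq_ltn_trans (leq_div w (3 * h)) wW; have le := leq_trunc_div w (3 * h).
rewrite subn_gt0 => d1; rewrite divE // subE ?(ltnW d1) //; split=> //.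
by rewrite -subSn ?(ltnW d1) // subSS subn0 mulnC.
Qed.

Lemma setup_correct w h q s n m :
  let B := 2 ^ (h * (3 * q)) in
  eval_op w Sub (eval_op w Div w (3 * h)) 1 = q -> 3 * h * q.+1 <= w ->
  0 < h -> 0 < q -> n < B -> m < B ->
  reg s rN = n -> reg s rM = m -> reg s rW = w -> mem s (3 * B) = 0 ->
  runs w (setup h) s (20 * 2 ^ q + 60) (fun s' =>
    [/\ env w q h s', reg s' rCellsT = (n + w.-1) %/ w,
        reg s' rCells = (m + w.-1) %/ w
      & frame setup_scratch (3 * B) (4 * B) s s']).
Proof.
move=> B qE hq h0 q0 nB mB hn hm hw mem0.
have wB : h * (3 * q) + 3 <= w by nia.
have B8 : 8 * B <= 2 ^ w by rewrite /B -[8]/(2 ^ 3) -expnD leq_exp2l // addnC.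
have B0 : 0 < B by exact: expn_gt0.
have w'B : h * (3 * q) < B by exact: ltn_expl.
have qB : 3 * q <= h * (3 * q) by exact: leq_pmull.
have q8 : 8 ^ q <= B by rewrite expn8 leq_exp2l.
have wW : w < 2 ^ w by exact: ltn_expl.
have q80 : 0 < 8 ^ q by exact: expn_gt0.
have q2 : 2 ^ q <= B by rewrite leq_exp2l //; lia.
have w0 : 0 < w by lia.
have nw x : x < B -> x + (w - 1) < 2 ^ w.
  move=> xB; have w2 : 2 * w <= 2 ^ w.
    by case: (w) w0 => // v _; rewrite expnS leq_pmul2l // ltn_expl.
  by lia.
have cst v : v < 8 -> v %% 2 ^ w = v by move=> hv; rewrite modn_small //; lia.
have h3 : 3 * h %% 2 ^ w = 3 * h by rewrite modn_small //; nia.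
have h1 : h %% 2 ^ w = h by rewrite modn_small //; nia.
eapply runs_time.
  apply: (runs_set_seq (v := q)).
    by rewrite /= hw h3 cst.
  apply: (runs_set_seq (v := 3 * q)).
    by rewrite /= /update /= cst // mulE //; lia.
  apply: (runs_set_seq (v := h * (3 * q))).
    by rewrite /= /update /= h1 mulE //; lia.
  apply: (runs_set_seq (v := B)).
    by rewrite /= /update /= cst // shlE mul1n // -/B; lia.
  apply: (runs_set_seq (v := 2 * B)).
    by rewrite /= /update /= cst // mulE //; lia.
  apply: (runs_set_seq (v := 3 * B)).
    by rewrite /= /update /= cst // mulE //; lia.
  apply: (runs_set_seq (v := 8 ^ q - 1)).
    by rewrite /= /update /= cst // shlE mul1n -expn8 ?subE //; lia.
  apply: (runs_set_seq (v := ones q)).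
    by rewrite /= /update /= cst // divE ?ones_div //; lia.
  apply: (runs_set_seq (v := (n + w.-1) %/ w)).
    rewrite /= /update /= cst // hn hw (@subE w w) //.
    by rewrite addE ?nw // divE ?nw // subn1.
  apply: (runs_set_seq (v := (m + w.-1) %/ w)).
    rewrite /= /update /= cst // hm hw (@subE w w) //.
    by rewrite addE ?nw // divE ?nw // subn1.
  eapply runs_weaken.
  - apply: (build_table_correct (q := q)) => //; first lia.
    by rewrite /= /update /= -expn8; lia.
  - exact: leqnn.
  - move=> s' [tab fr].
    have fr' : frame setup_scratch (3 * B) (4 * B) s s'.
      apply: frame_trans (frame_sub _ _ _ fr).
      + by do 10 (apply: frame_set => //).
      + by move=> r; rewrite !inE => /orP [] /eqP ->.
      + by rewrite /= /update.
      + by rewrite /= /update /=; lia.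
    by split=> //; first split=> //; rewrite (proj1 fr) //= /update /=.
by rewrite /=; lia.
Qed.

Definition build_texts (h : nat) : cmd :=
  rDst ::= $rRegion;;
  rU ::= #0;;
  rSrc ::= #0;;
  rLen ::= $rN;;
  rLim ::= $rN;;
  rFill ::= $rFull;;
  encode_block h;;
  rTextChunks ::= $rU;;
  build_patterns h;;
  sim_reg 0 0 ::= $rChunk * $rU;;
  sim_reg 0 1 ::= $rWord;;
  rDst ::= $rRegion2;;
  rU ::= #0;;
  build_patterns h;;
  sim_reg 1 0 ::= $rChunk * $rU;;
  sim_reg 1 1 ::= $rWord.

Lemma bounded_start w args input : all (fun x => x < 2 ^ w) args ->
  all (fun x => x < 2 ^ w) input -> bounded w (start args input).
Proof.
have nth_lt l x : all (fun x => x < 2 ^ w) l -> nth 0 l x < 2 ^ w.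
  move=> /allP hl; have [lt|ge] := ltnP x (size l); first by rewrite hl ?mem_nth.
  by rewrite nth_default ?expn_gt0.
by move=> ha hi; split=> x /=; exact: nth_lt.
Qed.

Lemma sub_cons (X : seq register) r Z : {subset X <= Z} -> {subset X <= r :: Z}.
Proof. by move=> XZ x /XZ xZ; rewrite in_cons xZ orbT. Qed.

(** The state [prep_start] fixes all cells and registers, so the region must be clean past the text,
    and all registers of the machine but two must still be 0. *)
Lemma embeds_prep_start w' rho st S s : 0 < w' -> size S < 2 ^ w' ->
  reg s (rho 0) = size S -> reg s (rho 1) = w' ->
  (forall r, 1 < r -> reg s (rho r) = 0) -> text_at w' st s S ->
  embeds w' rho st (prep_start w' S) s.
Proof.
move=> w0 szS h0 h1 h2 txt; split.
- by case=> [|[|r]] //=; rewrite h2 // nth_nil.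
- by move=> a aB; rewrite txt // /= nth_pack.
- apply: (@bounded_start w' [:: size S; w']); last exact: pack_lt.
  have w'B : w' < 2 ^ w' by exact: ltn_expl.
  by rewrite /= szS w'B.
Qed.

Lemma build_texts_correct w q h s T D m cT cP :
  let B := 2 ^ (h * (3 * q)) in
  let X := padded q (size T) true T in
  let U := pattern_blocks q (m + q) D in
  let L := ((m + q) %/ q).+1 in
  0 < q -> 0 < h -> h * (3 * q) + 2 <= w -> env w q h s ->
  reg s rN = size T -> reg s rK = size D -> reg s rM = m ->
  reg s rCellsT = cT -> reg s rCells = cP ->
  (forall i x, reg s (sim_reg i x) = 0) ->
  (forall a, B <= a < 3 * B -> mem s a = 0) ->
  all (fun p => size p == m) D ->
  cT + size D * cP + (m + q) + q + 2 < B -> size T + q + 2 < B ->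
  3 * q * ((size T %/ q).+1 + 2 * L * size D) < B ->
  source_at w 0 s T ->
  (forall i, i < size D -> source_at w (cT + i * cP) s (nth [::] D i)) ->
  runs w (build_texts h) s
    (100 * (size T %/ q).+1 + 500 * L * (size D).+1 + 40) (fun s' =>
    [/\ env w q h s', reg s' rK = size D, reg s' rM = m &
     [/\ reg s' rTextChunks = (size T %/ q).+1,
         embeds (h * (3 * q)) (sim_reg 0) B (prep_start (h * (3 * q)) (X ++ U)) s'
       & embeds (h * (3 * q)) (sim_reg 1) (2 * B) (prep_start (h * (3 * q)) U) s']]).
Proof.
move=> B X U L q0 h0 hw E hn hk hm hcT hcP sim0 mem0 szD big1 big2 room srcT srcD.
set w' := h * (3 * q) in hw B E mem0 big1 big2 room *; set A := (size T %/ q).+1 in room *.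
have BW : B * 4 <= 2 ^ w by rewrite -(expnD 2 _ 2) leq_exp2l.
have w'0 : 0 < w' by rewrite !muln_gt0 h0 q0.
have qw' : 3 * q <= w' by exact: leq_pmull.
have Bq : 2 ^ q <= B by rewrite leq_exp2l //; lia.
have w'B : w' < B by exact: ltn_expl.
have W0 : 0 %% 2 ^ w = 0 by exact: mod0n.
have small_text st s1 : (forall a, B <= a < 3 * B -> mem s1 a = 0) ->
    B <= st -> st + B <= 3 * B -> text_at w' st s1 [::].
  by move=> z h1 h2 a aB; rewrite z ?/word /= ?div0n ?mod0n //; rewrite -/B in aB; lia.
have szX : size X = 3 * q * A by exact: size_padded.
have leD : all (fun p => size p <= m + q) D.
  by apply/allP => x xD; rewrite (eqP (allP szD _ xD)) leq_addr.
have szU : size U = 3 * q * (2 * L * size D) by exact: size_pattern_blocks.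
have out12 i r x : r < 40 -> sim_reg i x == r = false.
  by move=> r40; apply/negbTE; rewrite eq_sym sim_reg_big.
have simX i x Z : all (fun r => r < 40) Z -> sim_reg i x \notin Z.
  move=> /allP z; apply/negP => /z; rewrite /sim_reg; lia.
have srcB a b cc (x : seq bool) s1 s2 : cc + size x <= B -> frame b B a s1 s2 ->
    source_at w cc s1 x -> source_at w cc s2 x.
  move=> ccB [_ fm] so y hy; rewrite fm ?so //; left.
  have : y <= y * w by apply: leq_pmulr; lia.
  by lia.
eapply runs_time.
  apply: (runs_set_seq (v := B)); first by rewrite /= (env_region E).
  apply: (runs_set_seq (v := 0)); first by rewrite /=.
  apply: (runs_set_seq (v := 0)); first by rewrite /=.
  apply: (runs_set_seq (v := size T)); first by rewrite /= /update.
  apply: (runs_set_seq (v := size T)); first by rewrite /= /update.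
  apply: (runs_set_seq (v := 8 ^ q - 1)); first by rewrite /= /update /= (env_full E).
  set s1 := set_reg (set_reg _ _ _) _ _.
  pose Z := rDst :: rTextChunks :: build_scratch.
  have fr1 : frame Z B (3 * B) s s1 by do 6 (apply: frame_set => //).
  have E1 : env w q h s1 by apply: env_frame fr1 E.
  apply: runs_seq; eapply runs_weaken; first apply: (encode_block_correct (q := q)
    (bits := T) (f := true) (src := 0) (lim := size T) (dst := B) (u := 0) (S := [::])) => //.
  + by rewrite -/w' -/B; lia.
  + by apply: small_text => //; lia.
  + by rewrite muln0.
  + by rewrite add0n -/A -/w' -/B; apply: leq_ltn_trans room; rewrite leq_mul2l; lia.
  + exact: leqnn.
  move=> s2; rewrite -/A -/X add0n cat0s -/w' -/B => -[ht2 hu2 fr2].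
  have fr2' : frame Z B (3 * B) s s2.
    apply: frame_trans fr1 _; apply: frame_sub fr2 => //.
      by do 2 (apply: sub_cons); move=> r hr; rewrite mem_cat hr.
    by rewrite -?/w' -?/B; lia.
  apply: (runs_set_seq (v := A)); first by rewrite /=.
  set s3 := set_reg _ _ _.
  have fr3 : frame Z B (3 * B) s s3 by apply: frame_set.
  have E3 : env w q h s3 by apply: env_frame fr3 E.
  have high3 a : 2 * B <= a < 3 * B -> mem s3 a = 0.
    by move=> ha; rewrite /= (proj2 fr2) /= ?mem0 //; lia.
  have srcB3 cc b : cc + size b <= B -> source_at w cc s b -> source_at w cc s3 b.
    by move=> le; exact: srcB le fr3.
  apply: runs_seq; eapply runs_weaken; first apply: (build_patterns_correct (q := q)
    (m := m) (D := D) (cT := cT) (cP := cP) (S := X) (dst := B) (u := A)) => //.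
  + by rewrite -/w' -/B; lia.
  + by rewrite (proj1 fr3).
  + by rewrite (proj1 fr3).
  + by rewrite (proj1 fr3).
  + by rewrite (proj1 fr3).
  + by rewrite /= /update /= (proj1 fr2).
  + move=> i iD; apply: srcB3; last exact: srcD.
    have szp : size (nth [::] D i) = m by apply/eqP; apply: (allP szD); rewrite mem_nth.
    have : i * cP <= size D * cP by rewrite leq_mul2r (ltnW iD) orbT.
    by rewrite szp; lia.
  + exact: leqnn.
  move=> s4; rewrite -/L -/w' -/B -/U => -[ht4 hu4 fr4].
  have fr4' : frame Z B (3 * B) s s4.
    apply: frame_trans fr3 _; apply: frame_sub fr4 => //.
      by do 2 (apply: sub_cons).
    by rewrite -?/w' -?/B; lia.
  have E4 : env w q h s4 by apply: env_frame fr4' E.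
  apply: (runs_set_seq (v := size (X ++ U))).
    rewrite /= (env_chunk E4) hu4 mulE.
      by rewrite size_cat szX szU -mulnDr.
    by apply: leq_ltn_trans (_ : B < _); lia.
  apply: (runs_set_seq (v := w')).
    by rewrite /= /update /= (env_word E4).
  apply: (runs_set_seq (v := 2 * B)).
    by rewrite /= /update /= (env_region2 E4).
  apply: (runs_set_seq (v := 0)); first by rewrite /=.
  set s5 := set_reg (set_reg _ _ _) _ _.
  pose Z' := sim_reg 0 0 :: sim_reg 0 1 :: Z.
  have fr5 : frame Z' B (3 * B) s s5.
    do 4 (apply: frame_set => //); apply: frame_sub fr4' => //.
    by do 2 (apply: sub_cons).
  have E5 : env w q h s5 by apply: env_frame fr5 E.
  apply: runs_seq; eapply runs_weaken; first apply: (build_patterns_correct (q := q)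
    (m := m) (D := D) (cT := cT) (cP := cP) (S := [::]) (dst := 2 * B) (u := 0)) => //.
  + by rewrite -/w' -/B; lia.
  + by rewrite -/w' -/B; lia.
  + by rewrite (proj1 fr5).
  + by rewrite (proj1 fr5).
  + by rewrite (proj1 fr5).
  + by rewrite (proj1 fr5).
  + move=> i iD; apply: (srcB _ _ _ _ _ _ _ fr5); last exact: srcD.
    have szp : size (nth [::] D i) = m by apply/eqP; apply: (allP szD); rewrite mem_nth.
    have : i * cP <= size D * cP by rewrite leq_mul2r (ltnW iD) orbT.
    by rewrite szp; lia.
  + move=> a aB; rewrite /word div0n mod0n /= (proj2 fr4) ?high3 -/B //.
      by rewrite -/B in aB; lia.
    by rewrite -/B in aB; lia.
  + by rewrite muln0.
  + rewrite add0n -/w' -/B -/L; apply: leq_ltn_trans room; rewrite leq_mul2l; lia.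
  + exact: leqnn.
  move=> s6; rewrite -/L -/w' -/B -/U add0n cat0s => -[ht6 hu6 fr6].
  have fr6' : frame Z' B (3 * B) s s6.
    apply: frame_trans fr5 _; apply: frame_sub fr6 => //.
    - by do 4 (apply: sub_cons).
    - by lia.
    - by lia.
  have E6 : env w q h s6 by apply: env_frame fr6' E.
  apply: (runs_set_seq (v := size U)).
    rewrite /= (env_chunk E6) hu6 mulE; first by rewrite szU.
    have le : 3 * q * (2 * L * size D) <= 3 * q * (A + 2 * L * size D).
      by rewrite leq_mul2l leq_addl orbT.
    by apply: leq_ltn_trans le _; lia.
  apply: (runs_set_last (v := w')).
    by rewrite /= /update /= (env_word E6).
  set s7 := set_reg _ _ _.
  have fr7 : frame (sim_reg 1 0 :: sim_reg 1 1 :: Z') B (3 * B) s s7.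
    do 2 (apply: frame_set => //); apply: frame_sub fr6' => //.
    by do 2 (apply: sub_cons).
  split.
  - exact: env_frame fr7 E.
  - by rewrite (proj1 fr7).
  - by rewrite (proj1 fr7).
  split.
  - by rewrite /= /update /= (proj1 fr6) //= /update /= (proj1 fr4).
  - apply: embeds_prep_start => //.
    + by rewrite size_cat szX szU -mulnDr.
    + by rewrite /= /update /= (proj1 fr6).
    + by rewrite /= /update /= (proj1 fr6).
    + move=> r r1; rewrite (proj1 fr7) ?sim0 // 4!in_cons (negbTE (simX _ _ Z _)) //.
      by rewrite /sim_reg; lia.
    + move=> a aB; rewrite -/w' -/B in aB; rewrite /= (proj2 fr6) /= ?ht4 //; lia.
  - apply: embeds_prep_start => //.
    + by rewrite szU; apply: leq_ltn_trans room; rewrite leq_mul2l; lia.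
    + move=> r r1; rewrite (proj1 fr7) ?sim0 // 4!in_cons (negbTE (simX _ _ Z _)) //.
      by rewrite /sim_reg; lia.
by rewrite /= -/A; lia.
Qed.

(** * Queries to the two simulated structures *)

Definition queries_ok (w : nat) (X : isa_structure) (S : seq bool) (q : nat)
    (s0 : state) : Prop :=
  forall s j, after_queries w (query X) (size S) s0 s -> 1 <= j <= size S ->
  exists tr s', [/\ exec w (query X) (ask s j) tr s',
                    reg s' 0 = inverse_SA S j & time tr <= q].

Definition isa_run (w : nat) (X : isa_structure) (S : seq bool) (p q : nat) : Prop :=
  exists tr0 s0, [/\ exec w (prep X) (prep_start w S) tr0 s0,
                     time tr0 <= p & queries_ok w X S q s0].

Definition ask_cmd (i : nat) (base : register) (X : isa_structure) (r : register)
    (e : expr) : cmd :=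
  sim_reg i 0 ::= e;;
  simulate (sim_reg i) base rRegion (query X);;
  r ::= $(sim_reg i 0).

(** A query may change the structure, so the simulated state after it is handed on with
    [after_queries], ready for the next query. The rank is below [2 ^ w'] because it is the content
    of a simulated register; this keeps later sums of ranks within a word. *)
Lemma ask_correct w w' i base st X S q s0 sim s r e j :
  base < 40 -> r < 40 -> w' < w -> st + 2 ^ w' <= 2 ^ w -> size S < 2 ^ w' ->
  reg s base = st -> reg s rRegion = 2 ^ w' ->
  embeds w' (sim_reg i) st sim s ->
  queries_ok w' X S q s0 -> after_queries w' (query X) (size S) s0 sim ->
  eval w s e = j -> 1 <= j <= size S ->
  runs w (ask_cmd i base X r e) s (cost e + 3 * q + 2) (fun s' =>
    exists sim', [/\ embeds w' (sim_reg i) st sim' s',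
      after_queries w' (query X) (size S) s0 sim',
      reg s' r = inverse_SA S j, inverse_SA S j < 2 ^ w' &
      (forall x, x != r -> (forall y, x != sim_reg i y) -> reg s' x = reg s x) /\
      (forall a, a < st \/ st + 2 ^ w' <= a -> mem s' a = mem s a)]).
Proof.
move=> base40 r40 ww' fits szS hb hm emb ok aq ej hj.
have [tr [sim' [x e0 tq]]] := ok _ _ aq hj.
eapply runs_time.
  apply: (runs_set_seq ej).
  apply: runs_seq; eapply runs_weaken.
  - apply: (simulate_correct (@sim_reg_inj i) _ _ ww' fits x).
    + by move=> y; exact: sim_reg_big.
    + by move=> y; exact: sim_reg_big.
    + case: emb => h1 h2 h3; split=> //=.
      * by move=> y; rewrite /update (inj_eq (@sim_reg_inj i)) h1.
      * by apply: bounded_set_reg => //; lia.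
    + by rewrite /= /update (negbTE (sim_reg_big _ _ base40)).
    + by rewrite /= /update.
  - exact: leqnn.
  - move=> s' [emb' out]; apply: (runs_set_last (v := inverse_SA S j)).
      by case: emb' => h1 _ _; rewrite /= h1.
    have [g1 g2 [g3 g4]] := emb'.
    exists sim'; split.
    + split=> //=; move=> y; rewrite /update; case: eqP => // ry.
      by have := sim_reg_big i y r40; rewrite ry eqxx.
    + exact: after_query aq hj x.
    + by rewrite /= /update eqxx.
    + by rewrite -e0.
    + split=> [y hy hy'|a ha]; last exact: (proj2 out).
      by rewrite /= /update (negbTE hy) (proj1 out) //= /update (negbTE (hy' 0)).
by rewrite /= /time in tq *; lia.
Qed.

Lemma embeds_other w' rho st sim s s' :
  (forall x, reg s' (rho x) = reg s (rho x)) ->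
  (forall a, a < 2 ^ w' -> mem s' (st + a) = mem s (st + a)) ->
  embeds w' rho st sim s -> embeds w' rho st sim s'.
Proof.
move=> hr hmem [h1 h2 h3]; split=> // [x|a ha]; first by rewrite hr.
by rewrite hmem ?h2.
Qed.

Definition live (w' : nat) (X : isa_structure) (S1 S2 : seq bool) (s01 s02 s : state)
    : Prop :=
  exists sim1 sim2,
    [/\ embeds w' (sim_reg 0) (2 ^ w') sim1 s, embeds w' (sim_reg 1) (2 * 2 ^ w') sim2 s,
        after_queries w' (query X) (size S1) s01 sim1
      & after_queries w' (query X) (size S2) s02 sim2].

Lemma live_set w' X S1 S2 s01 s02 s r v : r < 40 ->
  live w' X S1 S2 s01 s02 s -> live w' X S1 S2 s01 s02 (set_reg s r v).
Proof.
move=> r40 [sim1 [sim2 [e1 e2 a1 a2]]]; exists sim1, sim2; split=> //.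
- apply: embeds_other e1 => //= x; rewrite /update; case: eqP => // e.
  by have := sim_reg_big 0 x r40; rewrite e eqxx.
- apply: embeds_other e2 => //= x; rewrite /update; case: eqP => // e.
  by have := sim_reg_big 1 x r40; rewrite e eqxx.
Qed.

Definition ask_both (X : isa_structure) (r1 r2 : register) : cmd :=
  ask_cmd 0 rRegion X r1 ($rOff + $rJ);; ask_cmd 1 rRegion2 X r2 ($rJ).

Lemma ask_both_correct w w' X S1 S2 q1 q2 s01 s02 s r1 r2 off j :
  r1 < 40 -> r2 < 40 -> r1 \notin [:: rRegion; rRegion2; rJ; r2] ->
  w' + 2 <= w -> size S1 < 2 ^ w' -> size S2 < 2 ^ w' ->
  reg s rRegion = 2 ^ w' -> reg s rRegion2 = 2 * 2 ^ w' ->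
  reg s rOff = off -> reg s rJ = j ->
  queries_ok w' X S1 q1 s01 -> queries_ok w' X S2 q2 s02 ->
  live w' X S1 S2 s01 s02 s ->
  1 <= j <= size S2 -> off + j <= size S1 ->
  runs w (ask_both X r1 r2) s (3 * q1 + 3 * q2 + 5) (fun s' =>
    [/\ live w' X S1 S2 s01 s02 s',
        reg s' r1 = inverse_SA S1 (off + j) /\ inverse_SA S1 (off + j) < 2 ^ w',
        reg s' r2 = inverse_SA S2 j /\ inverse_SA S2 j < 2 ^ w'
      & forall x, x < 40 -> x != r1 -> x != r2 -> reg s' x = reg s x]).
Proof.
move=> r140 r240; rewrite !inE !negb_or => /and4P [n1 n2 n3 n4].
move=> hw sz1 sz2 hb1 hb2 hoff hj ok1 ok2 [sim1 [sim2 [e1 e2 a1 a2]]] jU jX.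
have BW : 2 ^ w' * 4 <= 2 ^ w by rewrite -(expnD 2 _ 2) leq_exp2l.
eapply runs_time.
  apply: runs_seq; eapply runs_weaken.
  - apply: (ask_correct (w' := w') (st := 2 ^ w') (j := off + j) (s0 := s01)
      (sim := sim1) (S := S1) (q := q1)) => //; try lia.
    by rewrite /= hoff hj addE //; lia.
  - exact: leqnn.
  - move=> s1 [sim1' [e1' a1' v1 lt1 [fr1 fm1]]].
    eapply runs_weaken.
    + apply: (ask_correct (w' := w') (st := 2 * 2 ^ w') (j := j) (s0 := s02)
        (sim := sim2) (S := S2) (q := q2)) => //; try lia.
      * by rewrite fr1 1?eq_sym // => y; exact: sim_reg_big.
      * by rewrite fr1 1?eq_sym // => y; exact: sim_reg_big.
      * apply: embeds_other e2 => [x|a ha]; last by apply: fm1; right; lia.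
        rewrite fr1 // => [|y]; last by rewrite eq_sym sim_reg_disjoint.
        by rewrite eq_sym sim_reg_big.
      * by rewrite /= fr1 1?eq_sym // => y; exact: sim_reg_big.
    + exact: leqnn.
    + move=> s2 [sim2' [e2' a2' v2 lt2 [fr2 fm2]]]; split.
      * exists sim1', sim2'; split=> //.
        apply: embeds_other e1' => [x|a ha]; last by apply: fm2; left; lia.
        rewrite fr2 // => [|y]; last exact: sim_reg_disjoint.
        by rewrite eq_sym sim_reg_big.
      * by split=> //; rewrite fr2 // => y; exact: sim_reg_big.
      * by [].
      * by move=> x x40 x1 x2; rewrite fr2 ?fr1 // => y; exact: sim_reg_big.
by rewrite /=; lia.
Qed.

(** The blocks are visited in order, so [rJ] advances by one block at a time. As [rAns] counts the
    patterns found, it stays at most k and cannot overflow. *)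
Definition query_all (X : isa_structure) : cmd :=
  rOff ::= $rChunk * $rTextChunks;;
  rStep ::= $rChunk * (($rM + $rQ) %/ $rQ + #1);;
  rJ ::= #1;;
  rAns ::= #0;;
  rI ::= #0;;
  rMore ::= #0 < $rK;;
  CWhile rMore
    (ask_both X rLo1 rLo2;;
     rJ ::= $rJ + $rStep;;
     ask_both X rHi1 rHi2;;
     rJ ::= $rJ + $rStep;;
     rAns ::= $rAns + (#1 - ($rHi1 + $rLo2 == $rLo1 + $rHi2));;
     rI ::= $rI + #1;;
     rMore ::= $rI < $rK);;
  rN ::= #0 < $rAns.

Lemma query_all_correct w q h X s T D m q1 q2 s01 s02 :
  let B := 2 ^ (h * (3 * q)) in
  let A := padded q (size T) true T in
  let U := pattern_blocks q (m + q) D in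
  0 < q -> 0 < m -> 0 < size D -> h * (3 * q) + 2 <= w -> env w q h s ->
  reg s rK = size D -> reg s rM = m -> reg s rTextChunks = (size T %/ q).+1 ->
  all (fun p => size p == m) D -> m + q < B ->
  size (A ++ U) < B ->
  queries_ok (h * (3 * q)) X (A ++ U) q1 s01 -> queries_ok (h * (3 * q)) X U q2 s02 ->
  live (h * (3 * q)) X (A ++ U) U s01 s02 s ->
  runs w (query_all X) s (size D * (6 * q1 + 6 * q2 + 40) + 30) (fun s' =>
    reg s' 0 = has (fun p => infix p T) D).
Proof.
move=> B A U q0 m0 k0 hw E hk hm htc szD big szB ok1 ok2 lv.
set w' := h * (3 * q) in hw B E ok1 ok2 lv big szB *.
set L := ((m + q) %/ q).+1; set step := 3 * q * L.
have BW : B * 4 <= 2 ^ w by rewrite -(expnD 2 _ 2) leq_exp2l.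
have leD : all (fun p => size p <= m + q) D.
  by apply/allP => x xD; rewrite (eqP (allP szD _ xD)) leq_addr.
have szA : size A = 3 * q * (size T %/ q).+1 by exact: size_padded.
have szU : size U = 3 * q * (2 * L * size D) by exact: size_pattern_blocks.
have szUs : size U = 2 * size D * step by rewrite szU /step; lia.
rewrite (size_cat A) in szB.
have B0 : 0 < B by exact: expn_gt0.
have w0 : 0 < w by lia.
have cst v : v < 2 -> v %% 2 ^ w = v by move=> hv; rewrite modn_small //; lia.
have step0 : 0 < step by rewrite !muln_gt0 q0.
have stepU : step <= size U by rewrite szUs leq_pmull // muln_gt0 k0.
have D0 : size D <= size U.
  by rewrite szUs mulnAC leq_pmull // muln_gt0 step0.
pose Inv i s1 := let t := size D - i in [/\ i <= size D, reg s1 rI = t,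
  reg s1 rMore = (0 < i), reg s1 rJ = 2 * t * step + 1
  & [/\ reg s1 rAns = count (fun p => infix p T) (take t D), reg s1 rK = size D,
        [/\ reg s1 rOff = size A, reg s1 rStep = step,
            reg s1 rRegion = B & reg s1 rRegion2 = 2 * B]
      & live w' X (A ++ U) U s01 s02 s1]].
eapply runs_time.
  apply: (runs_set_seq (v := size A)).
    by rewrite /= (env_chunk E) htc mulE -szA //; lia.
  apply: (runs_set_seq (v := step)).
    rewrite /= /update /= hm (env_q E) (env_chunk E) cst // (@addE w m) ?divE; try lia.
    have leL : L <= step by rewrite /step leq_pmull // muln_gt0 q0.
    by rewrite (@addE w _ 1) addn1 -/L ?mulE // -/step; lia.
  apply: (runs_set_seq (v := 1)); first by rewrite /= cst.
  apply: (runs_set_seq (v := 0)); first by rewrite /= cst.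
  apply: (runs_set_seq (v := 0)); first by rewrite /= cst.
  apply: (runs_set_seq (v := 0 < size D)).
    by rewrite /= /update /= cst // hk ltE.
  (* Each pattern asks two queries of each structure, at 3 steps per simulated step. *)
  apply: runs_seq; eapply runs_weaken;
    first apply: (@runs_while _ _ _ (6 * q1 + 6 * q2 + 35) Inv _ _ (size D)).
  - move=> i s1 [iD hi hmore hj [hans hk1 [hoff hstep hB hB2] lv1]].
    split; first by rewrite hmore.
    set t := size D - i.+1 in hi hj hans *.
    have tD : t < size D by rewrite /t; lia.
    have et : size D - i = t.+1 by rewrite /t; lia.
    have jt : 2 * t.+1 * step <= size U by rewrite szUs leq_mul2r leq_mul2l tD !orbT.
    set j := 2 * t * step + 1 in hj *.
    have jlo : 1 <= j <= size U by rewrite /j; lia.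
    have jhi : 1 <= j + step <= size U by rewrite /j; lia.
    eapply runs_time.
      apply: runs_seq; eapply runs_weaken.
      + apply: (ask_both_correct (w' := w') (off := size A) (j := j) _ _ _ hw _ _ hB hB2
          hoff hj ok1 ok2 lv1) => //; rewrite ?(size_cat A) -/B; lia.
      + exact: leqnn.
      move=> s2 [lv2 [v1 l1] [v2 l2] fr2].
      apply: (runs_set_seq (v := j + step)).
        by rewrite /= !fr2 // hj hstep addE //; lia.
      set s3 := set_reg _ _ _.
      have lv3 : live w' X (A ++ U) U s01 s02 s3 by exact: live_set.
      have fr3 x : x < 40 -> x \notin [:: rLo1; rLo2; rJ] -> reg s3 x = reg s1 x.
        move=> x40; rewrite !inE !negb_or => /and3P [n1 n2 n3].
        by rewrite /= /update (negbTE n3) fr2.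
      apply: runs_seq; eapply runs_weaken.
      + apply: (ask_both_correct (w' := w') (off := size A) (j := j + step) _ _ _ hw _ _ _ _
          _ _ ok1 ok2 lv3) => //; rewrite ?fr3 // ?(size_cat A) -/B; lia.
      + exact: leqnn.
      move=> s4 [lv4 [v3 l3] [v4 l4] fr4].
      have det := detect_occurrence T q0 m0 szD tD.
      rewrite -/A -/U -/L -/step -/j in det.
      apply: (runs_set_seq (v := 2 * t.+1 * step + 1)).
        by rewrite /= !fr4 // /s3 /= /update /= !fr2 // hstep addE; rewrite /j; lia.
      apply: (runs_set_seq (v := count (fun p => infix p T) (take t.+1 D))).
        have e1 : reg s4 rLo1 = inverse_SA (A ++ U) (size A + j) by rewrite fr4.
        have e2 : reg s4 rLo2 = inverse_SA U j by rewrite fr4.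
        have e3 : reg s4 rAns = count (fun p => infix p T) (take t D) by rewrite fr4 // fr3.
        rewrite /= /update /= v3 v4 e1 e2 e3 cst //.
        have ct : count (fun p => infix p T) (take t D) <= size D.
          by apply: leq_trans (count_size _ _) _; rewrite size_take; case: ifP; lia.
        rewrite -/B in l1 l2 l3 l4.
        rewrite (@addE w (inverse_SA (A ++ U) (size A + (j + step))))
          ?(@addE w (inverse_SA (A ++ U) (size A + j))); try lia.
        rewrite eqE // subE ?leq_b1 //; last by lia.
        rewrite (take_nth [::]) // -cats1 count_cat /= addn0 -det.
        rewrite addE; first by case: eqP.
        by apply: leq_ltn_trans (leq_add ct (leq_subr _ 1)) _; lia.
      apply: (runs_set_seq (v := t.+1)).
        by rewrite /= /update /= fr4 // fr3 // hi cst // addE; lia.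
      apply: (runs_set_last (v := t.+1 < size D)).
        by rewrite /= /update /= fr4 // fr3 // hk1 ltE.
      split.
      + by lia.
      + by rewrite et.
      + by rewrite /= /update /= /t; congr nat_of_bool; lia.
      + by rewrite et.
      + split; rewrite ?et //=.
        * by rewrite /update /= fr4 // fr3.
        * by split; rewrite /update /= fr4 // fr3.
    by rewrite /=; lia.
  - by move=> s1 [].
  - split=> //; rewrite ?subnn ?take0 //=.
    split=> //; first by split=> //; rewrite /update /= ?(env_region E) ?(env_region2 E).
  - exact: leqnn.
  - move=> s' [_ _ _ _ [hans _ _ _]]; rewrite subn0 take_size in hans.
    apply: (runs_set_last (v := 0 < count (fun p => infix p T) D)).
      by rewrite /= cst // hans ltE.
    by rewrite /= /update /= has_count.
by rewrite /=; lia.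
Qed.

Definition reduction_cmd (h : nat) (X : isa_structure) : cmd :=
  setup h;;
  build_texts h;;
  simulate (sim_reg 0) rRegion rRegion (prep X);;
  simulate (sim_reg 1) rRegion2 rRegion (prep X);;
  query_all X.

(* Moves the arguments from registers 1, 2, 3 to the even registers that
   represent them. *)
Definition spread_arguments : program :=
  Seq (Op 6 Or 3 3) (Seq (Op 4 Or 2 2) (Op 2 Or 1 1)).

(** The parameter [h] will depend on [c] alone and [q] is computed from [w], so one program serves
    all [k] and [m], as [dm_fast] demands. *)
Definition reduction (h : nat) (X : isa_structure) : program :=
  Seq spread_arguments (compile (reduction_cmd h X)).

(** Register 2 is both a source and a target, so the arguments move from the last to the first. *)
Lemma spread_arguments_correct w a0 a1 a2 a3 input :
  a1 < 2 ^ w -> a2 < 2 ^ w -> a3 < 2 ^ w ->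
  exists s, exec w spread_arguments (start [:: a0; a1; a2; a3] input)
              [:: None; None; None] s /\ represents (start [:: a0; a1; a2; a3] input) s.
Proof.
move=> h1 h2 h3; eexists; split.
  apply: (@exec_seq _ _ _ _ _ _ [:: None] [:: None; None]); first exact: exec_op.
  by apply: (@exec_seq _ _ _ _ _ _ [:: None] [:: None]); exact: exec_op.
split=> // r; rewrite /= /update /= /eval_op !PeanoNat.Nat.lor_diag !modn_small //.
case: r => [|[|[|[|r]]]] //.
do 3 (case: eqP => [|_]; first lia).
by rewrite [RHS]nth_default // nth_default //= ; lia.
Qed.

Lemma nth_flatten_const (ss : seq (seq nat)) c i a : all (fun s => size s == c) ss ->
  i < size ss -> a < c -> nth 0 (flatten ss) (i * c + a) = nth 0 (nth [::] ss i) a.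
Proof.
elim: ss i => // s ss IH [|i] /= /andP [/eqP sc hss] iss ac; rewrite nth_cat sc.
  by rewrite mul0n ac.
by rewrite mulSn -addnA ltnNge leq_addr /= addKn IH.
Qed.

Lemma lt_cells w n a : 0 < w -> a * w < n -> a < (n + w.-1) %/ w.
Proof.
by move=> w0 h; rewrite leq_divRL // mulSn; lia.
Qed.

(** The three size conditions make the input end before the first region and the length of [S] a
    word of [w'] bits. *)
Lemma reduction_correct X h w q n k m (T : n.-tuple bool)
    (D : k.-tuple (m.-tuple bool)) p1 p2 q1 q2 :
  let w' := h * (3 * q) in
  let U := pattern_blocks q (m + q) [seq tval p | p <- D] in
  let S := padded q n true T ++ U in
  let L := ((m + q) %/ q).+1 in
  q = w %/ (3 * h) - 1 -> 0 < h -> 0 < q -> 0 < m -> 0 < k ->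
  (n + w.-1) %/ w + k * ((m + w.-1) %/ w) + (m + q) + q + 2 < 2 ^ w' ->
  n + q + 2 < 2 ^ w' -> 3 * q * ((n %/ q).+1 + 2 * L * k) < 2 ^ w' ->
  isa_run w' X S p1 q1 -> isa_run w' X U p2 q2 ->
  exists tr s',
    [/\ exec w (reduction h X) (start [:: n; k; m; w] (dm_input w T D)) tr s',
        reg s' 0 = dm_answer T D
      & time tr <= 20 * 2 ^ q + 100 * (n %/ q).+1 + 500 * L * k.+1
                   + 3 * (p1 + p2) + k * (6 * q1 + 6 * q2 + 40) + 140].
Proof.
move=> w' U S L eq h0 q0 m0 k0 big1 big2 room run1 run2.
set cT := (n + w.-1) %/ w in big1; set cP := (m + w.-1) %/ w in big1.
set D' := [seq tval p | p <- D] in U S run1 run2 *.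
set B := 2 ^ w' in big1 big2 room *.
have [qE hq] : eval_op w Sub (eval_op w Div w (3 * h)) 1 = q /\ 3 * h * q.+1 <= w.
  by move: q0; rewrite eq; exact: chunk_size.
clear eq.
have ww' : w' + 2 <= w by rewrite /w'; move: hq; rewrite mulnS; lia.
have w0 : 0 < w by lia.
have cP0 : 0 < cP by rewrite divn_gt0 //; lia.
have kcP : k <= k * cP by exact: leq_pmulr.
have nB : n < B by lia.
have mB : m < B by lia.
have kB : k < B by lia.
have BW : B * 4 <= 2 ^ w by rewrite -(expnD 2 _ 2) leq_exp2l.
have BW1 : B <= 2 ^ w by apply: leq_trans BW; exact: leq_pmulr.
have wW : w < 2 ^ w by exact: ltn_expl.
have szD' : size D' = k by rewrite size_map size_tuple.
have szDm : all (fun p => size p == m) D'.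
  by apply/allP => x /mapP [p _ ->]; rewrite size_tuple.
have szT : size T = n by exact: size_tuple.
set cs := start [:: n; k; m; w] (dm_input w T D).
have bcs : bounded w cs.
  apply: bounded_start; first by rewrite /= wW !andbT; rewrite !(leq_trans _ BW1).
  rewrite all_cat pack_lt; apply/allP => x /flattenP [l /mapP [p _ ->]].
  exact: (allP (pack_lt _ _)).
have size_flat (l : seq (m.-tuple bool)) :
    size (flatten [seq pack w (tval p) | p <- l]) = size l * cP.
  by elim: l => //= p l IH; rewrite size_cat IH size_pack size_tuple mulSn.
have size_in : size (dm_input w T D) = cT + k * cP.
  by rewrite size_cat size_pack szT size_flat size_tuple.
(* Hence both regions and entry 0 of the table start out as zeros. *)
have zero a : B <= a -> mem cs a = 0.
  by move=> aB; rewrite /= nth_default // size_in; lia.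
have srcT : source_at w 0 cs T.
  move=> a; rewrite szT => ha.
  by rewrite add0n /= nth_cat size_pack szT -/cT lt_cells // nth_pack.
have srcD i : i < size D' -> source_at w (cT + i * cP) cs (nth [::] D' i).
  move=> iD a; have -> : size (nth [::] D' i) = m.
    by apply/eqP; apply: (allP szDm); rewrite mem_nth.
  move=> ha; rewrite /= nth_cat size_pack szT -/cT -addnA ltnNge leq_addr /= addKn.
  have iDk : i < size D by rewrite size_tuple -szD'.
  have -> : [seq pack w (tval p) | p <- D] = [seq pack w p | p <- D'].
    by rewrite -map_comp.
  rewrite (nth_flatten_const (c := cP)) ?size_map //; last exact: lt_cells.
    by rewrite (nth_map [::]) // nth_pack.
  by apply/allP => x /mapP [p pD ->]; rewrite size_pack (eqP (allP szDm _ pD)).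
have [t [cs' [x tle ans]]] : runs w (reduction_cmd h X) cs
    (20 * 2 ^ q + 100 * (n %/ q).+1 + 500 * L * k.+1
     + 3 * (p1 + p2) + k * (6 * q1 + 6 * q2 + 40) + 137)
    (fun s' => reg s' 0 = dm_answer T D).
  have [tr1 [s01 [x1 t1 ok1]]] := run1; have [tr2 [s02 [x2 t2 ok2]]] := run2.
  eapply runs_time.
    apply: runs_seq; eapply runs_weaken.
    - apply: (setup_correct (n := n) (m := m) qE hq) => //.
      by apply: zero; rewrite -/w' -/B leq_pmull.
    - exact: leqnn.
    rewrite -/w' -/B -/cT -/cP => s1 [E1 c1 c2 fr1].
    apply: runs_seq; eapply runs_weaken.
    - apply: (build_texts_correct (q := q) (T := T) (D := D') (m := m) (cT := cT) (cP := cP));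
        rewrite ?szT ?szD' // ?(proj1 fr1) //.
      + move=> i x; have le40 : 40 <= sim_reg i x by rewrite /sim_reg; lia.
        rewrite (proj1 fr1); first by rewrite [LHS]nth_default //; exact: leq_trans le40.
        have /allP small : all (fun r => r < 40) setup_scratch by [].
        by apply/negP => /small; rewrite ltnNge le40.
      + by move=> a; rewrite -/w' -/B => aB; rewrite (proj2 fr1) ?zero //; lia.
      + move=> a ha; rewrite (proj2 fr1) ?srcT //; left.
        by have := leq_pmulr a w0; lia.
      + move=> i iD a; have -> : size (nth [::] D' i) = m.
          by apply/eqP; apply: (allP szDm); rewrite mem_nth ?szD'.
        move=> ha; rewrite (proj2 fr1) ?srcD ?szD' //.
          by rewrite (eqP (allP szDm _ _)) // mem_nth ?szD'.
        have := leq_pmulr a w0; have : i * cP <= k * cP by rewrite leq_mul2r (ltnW iD) orbT.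
        by left; lia.
    - exact: leqnn.
    rewrite szT szD' -/w' -/B -/U -/S => s2 [E2 hk2 hm2 [htc e1 e2]].
    apply: runs_seq; eapply runs_weaken.
    - apply: (simulate_correct (@sim_reg_inj 0) _ _ _ _ x1 e1).
      + by move=> y; exact: sim_reg_big.
      + by move=> y; exact: sim_reg_big.
      + by lia.
      + by rewrite -/B; lia.
      + by rewrite (env_region E2).
      + by rewrite (env_region E2).
    - exact: leqnn.
    move=> s3 [e1' out3].
    have keep3 r : r < 40 -> reg s3 r = reg s2 r.
      by move=> r40; rewrite (proj1 out3) // => y; exact: sim_reg_big.
    have e2' : embeds w' (sim_reg 1) (2 * B) (prep_start w' U) s3.
      apply: embeds_other e2 => [x|a ha].
        by rewrite (proj1 out3) // => y; rewrite eq_sym sim_reg_disjoint.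
      by rewrite (proj2 out3) // -/B; right; lia.
    apply: runs_seq; eapply runs_weaken.
    - apply: (simulate_correct (@sim_reg_inj 1) _ _ _ _ x2 e2').
      + by move=> y; exact: sim_reg_big.
      + by move=> y; exact: sim_reg_big.
      + by lia.
      + by rewrite -/B; lia.
      + by rewrite keep3 // (env_region2 E2).
      + by rewrite keep3 // (env_region E2).
    - exact: leqnn.
    move=> s4 [e2'' out4].
    have keep4 r : r < 40 -> reg s4 r = reg s2 r.
      by move=> r40; rewrite (proj1 out4) ?keep3 // => y; exact: sim_reg_big.
    have E4 : env w q h s4.
      case: (E2) => f1 f2 f3 f4 f5 f6 f7 f8 f9 f10.
      split; rewrite ?keep4 // => b sb.
      by rewrite (proj2 out4) ?(proj2 out3) ?f10 //; right; rewrite -/w' -/B; lia.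
    eapply runs_weaken.
    - apply: (query_all_correct (q := q) (T := T) (D := D') (m := m) (X := X) (h := h)
        (q1 := q1) (q2 := q2) (s01 := s01) (s02 := s02)) => //; rewrite ?keep4 ?szT ?szD' //.
      + by rewrite -/w' -/B; lia.
      + rewrite (size_cat (padded q n true T)) size_padded ?szT // size_pattern_blocks //.
          by rewrite szD' -/L -mulnDr.
        by apply/allP => x xD; rewrite (eqP (allP szDm _ xD)) leq_addr.
      + exists s01, s02; split; [|by []|exact: after_prep|exact: after_prep].
        apply: embeds_other e1' => [x|a ha].
          by rewrite (proj1 out4) // => y; exact: sim_reg_disjoint.
        by rewrite (proj2 out4) // -/B; left; lia.
    - exact: leqnn.
    - by move=> s5 ->; rewrite has_map.
  rewrite szT szD' -/L; rewrite /time in t1 t2; clear -t1 t2; lia.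
have [_ hx] := compile_correct x bcs.
have [s1 [x1 r1]] := @spread_arguments_correct w n k m w (dm_input w T D)
  (leq_trans kB BW1) (leq_trans mB BW1) wW.
have [tr [s' [x2 z2 r2]]] := hx _ r1.
exists ([:: None; None; None] ++ tr), s'; split; first exact: exec_seq x1 x2.
  by case: r2 => r2 _; rewrite -ans -r2 muln0.
by rewrite /time size_cat z2 /=; lia.
Qed.

(** * Asymptotics *)

Local Open Scope ring_scope.

Section Log2.
Context {R : realType}.
Implicit Types x y : R.

Lemma ln2_gt0 : 0 < ln 2 :> R.
Proof. by apply: ln_gt0; lra. Qed.

Lemma ler_log2 x y : 0 < x -> x <= y -> log2 x <= log2 y.
Proof.
move=> x0 xy; rewrite /log2 ler_pM2r ?invr_gt0 ?ln2_gt0 //.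
by rewrite ler_ln ?posrE // (lt_le_trans x0).
Qed.

Lemma log2_le_inv x y : 0 < x -> 0 < y -> log2 x <= log2 y -> x <= y.
Proof.
by move=> x0 y0; rewrite /log2 ler_pM2r ?invr_gt0 ?ln2_gt0 // ler_ln ?posrE.
Qed.

Lemma ltr_log2 x y : 0 < y -> log2 x < log2 y -> x < y.
Proof.
move=> y0 xy; rewrite ltNge; apply/negP => yx.
by have := ler_log2 y0 yx; rewrite leNgt xy.
Qed.

Lemma log2M x y : 0 < x -> 0 < y -> log2 (x * y) = log2 x + log2 y.
Proof. by move=> x0 y0; rewrite /log2 lnM ?posrE // mulrDl. Qed.

Lemma log2Xn k : log2 (2 ^+ k) = k%:R :> R.
Proof.
rewrite /log2 lnXn ?ltr0n // -[ln 2 *+ k]mulr_natl mulfK //.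
by rewrite gt_eqF // ln2_gt0.
Qed.

Lemma log2_ge0 x : 1 <= x -> 0 <= log2 x.
Proof. by move=> x1; rewrite divr_ge0 ?ln_ge0 //; lra. Qed.

(** The inequality ln y <= y - 1 at y = sqrt x bounds ln x = 2 ln(sqrt x), and at y = 1/2 it gives
    ln 2 >= 1/2. *)
Lemma log2_le_sqrt x : 1 <= x -> log2 x <= 4 * Num.sqrt x.
Proof.
move=> x1; have s1 : 1 <= Num.sqrt x by rewrite -sqrtr1 ler_sqrt //; lra.
have ex : x = Num.sqrt x ^+ 2 by rewrite sqr_sqrtr //; lra.
have lnle y : 0 < y -> ln y <= y - 1.
  move=> y0; have := @le_ln1Dx R (y - 1).
  by rewrite (_ : 1 + (y - 1) = y); [apply; lra|ring].
have l2 : 1 / 2 <= ln 2 :> R.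
  have := lnle (1 / 2) ltac:(lra); rewrite div1r lnV ?posrE; lra.
have lx : ln x = 2 * ln (Num.sqrt x).
  by rewrite {1}ex lnXn; [rewrite mulr2n; lra|lra].
rewrite /log2 ler_pdivrMr ?ln2_gt0 // lx.
have := lnle (Num.sqrt x) ltac:(lra); nra.
Qed.

Lemma log2_near A : \forall n \near \oo, A <= log2 (n%:R : R).
Proof.
pose k := Num.bound `|A|.
have kA : A <= k%:R.
  by apply: le_trans (ler_norm _) _; apply: ltW; apply: archi_boundP; exact: normr_ge0.
near=> n; apply: le_trans kA _; rewrite -(log2Xn k); apply: ler_log2.
  by rewrite exprn_gt0.
rewrite -natrX ler_nat; near: n; exact: nbhs_infty_ge.
Unshelve. all: by end_near. Qed.

Lemma nat_above x : exists k : nat, x <= k%:R.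
Proof.
exists (Num.bound `|x|); apply: le_trans (ler_norm _) _; apply: ltW.
by apply: archi_boundP; exact: normr_ge0.
Qed.

End Log2.

(** * Sizes, addresses and construction time for a fixed large n *)

Lemma chunk_bounds (w h : nat) (q := (w %/ (3 * h) - 1)%N) :
  (12 * h <= w)%N -> (0 < h)%N ->
  [/\ (0 < q)%N, (3 * (h * q) <= w)%N, (w <= 3 * (h * q) + 6 * h)%N
    & (w <= 6 * (h * q))%N].
Proof.
move=> hw h0; have h30 : (0 < 3 * h)%N by rewrite muln_gt0.
have d4 : (4 <= w %/ (3 * h))%N by rewrite leq_divRL //; lia.
have := leq_trunc_div w (3 * h); have := ltn_ceil w h30.
rewrite /q; case: (w %/ (3 * h))%N d4 => // d d4.
rewrite subn1 /= => h1 h2; have := leq_mul (leqnn h) (d4 : 3 <= d)%N => h3.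
by split; lia.
Qed.

(** Rounding to chunks costs O(q) bits per block. Over all patterns this is O(wk), which is O(n)
    just as mk is, so it does not affect the order of the length. *)
Lemma text_length_bounds (n k m q w L : nat) : (0 < q)%N ->
  L = ((m + q) %/ q).+1 -> (q <= w)%N ->
  [/\ (m <= q * L)%N, (q * L <= m + 2 * q)%N, (n %/ q * q <= n)%N,
      (6 * (m * k) <= 3 * q * (2 * L * k))%N
    & (3 * q * ((n %/ q).+1 + 2 * L * k) <= 3 * n + 3 * w + 6 * (m * k) + 12 * (w * k))%N].
Proof.
move=> q0 eL qw; have := leq_trunc_div (m + q) q; have := ltn_ceil (m + q) q0.
have := leq_trunc_div n q; rewrite -eL; have -> : ((m + q) %/ q = L.-1)%N by rewrite eL.
have : (0 < L)%N by rewrite eL.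
case: L {eL} => // L _ /=; move: (n %/ q)%N => d dn h1 h2.
have e1 : (q * L.+1 <= m + 2 * q)%N by lia.
have e2 : (m <= q * L.+1)%N by lia.
split=> //; try lia.
- have := leq_mul e2 (leqnn k); lia.
- have := leq_mul e1 (leqnn k); have := leq_mul qw (leqnn k); lia.
Qed.

Lemma cells_bound (n w : nat) : (0 < w)%N -> ((n + w.-1) %/ w <= n + w)%N.
Proof. by move=> w0; apply: leq_trans (leq_div _ _) _; lia. Qed.

Lemma address_count_le (n w m k q cT cP : nat) :
  (cT <= n + w)%N -> (cP <= m + w)%N -> (q <= w)%N ->
  (cT + k * cP + (m + q) + q + 2 <= n + w + (m * k + w * k) + m + 2 * w + 2)%N.
Proof. by move=> h1 h2 h3; have := leq_mul (leqnn k) h2; lia. Qed.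

Section Bounds.
Context {R : realType} (c k0 k1 m0 m1 : R) (h e n w k m : nat).
Hypotheses (c2 : 2 <= c) (k00 : 0 < k0) (m00 : 0 < m0) (h0 : (0 < h)%N).
(** Since w <= (c + 1) log n, this gives 2q <= log n, so the table has at most sqrt n entries. *)
Hypothesis hh : 2 * (c + 1) <= 3 * h%:R.
Hypothesis n0 : (0 < n)%N.
Variable l : R.
Hypothesis lE : log2 n%:R = l.
Hypotheses (l1 : 1 <= l) (le_l : e%:R <= l) (lh : 12 * h%:R <= l).
Hypothesis ww : word_size c e n w.
Hypothesis kb : k0 * (n%:R / l) <= k%:R <= k1 * (n%:R / l).
Hypothesis mb : m0 * l <= m%:R <= m1 * l.
Let q := (w %/ (3 * h) - 1)%N.
Let w' := (h * (3 * q))%N.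
Let L := ((m + q) %/ q).+1.
Variable s : R.
Hypothesis sqrtE : Num.sqrt n%:R = s.

(* lra does not see the hypotheses of the section. *)
Ltac real_facts := have := c2; have := k00; have := m00; have := hh; have := l1;
  have := le_l; have := lh.
Ltac real_lra := real_facts; lra.

Let n1 : 1 <= n%:R :> R.
Proof. by rewrite ler1n. Qed.

Let l0 : 0 < l.
Proof. exact: lt_le_trans ltr01 l1. Qed.

Let nlE : n%:R / l * l = n%:R.
Proof. by rewrite divfK // gt_eqF. Qed.

Let nl0 : 0 < n%:R / l.
Proof. by rewrite divr_gt0 ?ltr0n. Qed.

Let s1 : 1 <= s.
Proof. by have n1' := n1; rewrite -sqrtE -[X in X <= _]sqrtr1 ler_sqrt //; real_lra. Qed.

Let sE : s * s = n%:R.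
Proof. by rewrite -sqrtE -expr2 sqr_sqrtr. Qed.

Let ls : l <= 4 * s.
Proof. by rewrite -lE -sqrtE; exact: log2_le_sqrt. Qed.

Let sn : s <= n%:R.
Proof. by have s1' := s1; rewrite -sE ler_peMl //; lra. Qed.

Let l_le_n : l <= 4 * n%:R.
Proof. by have := ls; have := sn; real_lra. Qed.

Let ww_bounds : c * l - e%:R <= w%:R /\ w%:R <= c * l + e%:R.
Proof.
have : `|w%:R - c * l| <= e%:R by rewrite -lE; exact: ww.
by rewrite ler_norml => /andP [a b]; split; real_lra.
Qed.

Let w_bounds : l <= w%:R <= (c + 1) * l.
Proof.
have cl : 2 * l <= c * l by rewrite ler_pM2r // l0.
by have [a b] := ww_bounds; apply/andP; split; real_lra.
Qed.

Let q_bounds : [/\ (0 < q)%N, (3 * (h * q) <= w)%N, (w <= 3 * (h * q) + 6 * h)%N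
    & (w <= 6 * (h * q))%N].
Proof.
apply: chunk_bounds => //; rewrite -(ler_nat R) natrM.
by apply: le_trans lh _; case/andP: w_bounds.
Qed.

Lemma chunk_pos : (0 < q)%N.
Proof. by case: q_bounds. Qed.

Lemma count_pos : (0 < k)%N.
Proof.
rewrite -(ltr_nat R); case/andP: kb => h1 _; apply: lt_le_trans h1.
exact: mulr_gt0.
Qed.

Lemma length_pos : (0 < m)%N.
Proof.
rewrite -(ltr_nat R); case/andP: mb => h1 _; apply: lt_le_trans h1.
exact: mulr_gt0.
Qed.

Let k1_ge0 : 0 <= k1.
Proof.
have := @ler0n R k; case/andP: kb => h1 h2 h3; have : 0 <= k1 * (n%:R / l) by real_lra.
by rewrite pmulr_lge0.
Qed.

Let m1_ge0 : 0 <= m1.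
Proof.
have := @ler0n R m; case/andP: mb => h1 h2 h3; have : 0 <= m1 * l by real_lra.
by rewrite pmulr_lge0.
Qed.

(** The factors log n of [k] and [m] cancel, so the patterns have total length Theta(n). *)
Let mk_bounds : m0 * k0 * n%:R <= (m * k)%:R <= m1 * k1 * n%:R.
Proof.
case/andP: kb => h1 h2; case/andP: mb => h3 h4; rewrite natrM.
have e1 : m0 * k0 * n%:R = (m0 * l) * (k0 * (n%:R / l)) by rewrite -{1}nlE; ring.
have e2 : m1 * k1 * n%:R = (m1 * l) * (k1 * (n%:R / l)) by rewrite -{1}nlE; ring.
have p1 : 0 <= m0 * l by rewrite mulr_ge0 ?ltW.
have p2 : 0 <= k0 * (n%:R / l) by rewrite mulr_ge0 ?ltW.
by rewrite e1 e2 !ler_pM.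
Qed.

Let wk_bound : (w * k)%:R <= (c + 1) * k1 * n%:R.
Proof.
case/andP: kb => h1 h2; case/andP: w_bounds => h3 h4; rewrite natrM.
have e2 : (c + 1) * k1 * n%:R = ((c + 1) * l) * (k1 * (n%:R / l)).
  by rewrite -{1}nlE; ring.
by rewrite e2 ler_pM.
Qed.

Let wn : w%:R <= 4 * (c + 1) * n%:R.
Proof. case/andP: w_bounds => _ hw; apply: le_trans hw _; rewrite (mulrC 4) -mulrA.
by rewrite ler_wpM2l //; have := c2; real_lra. Qed.

Let mn : m%:R <= 4 * m1 * n%:R.
Proof. case/andP: mb => _ hm; apply: le_trans hm _; rewrite (mulrC 4) -mulrA.
by rewrite ler_wpM2l. Qed.

(** A common bound for the coefficients of n in the text length and in the number of input
    addresses. *)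
Definition size_constant : R :=
  10 + 24 * (c + 1) + 4 * m1 + 6 * (m1 * k1) + 12 * ((c + 1) * k1).

Let qw : (q <= w)%N.
Proof. by case: q_bounds => _ h1 _ _; apply: leq_trans h1; rewrite mulnA leq_pmull // muln_gt0. Qed.

Let length_bounds := text_length_bounds n k chunk_pos (erefl L) qw.

Lemma text_length_le :
  (3 * q * ((n %/ q).+1 + 2 * L * k))%:R <= size_constant * n%:R.
Proof.
case: length_bounds => _ _ _ _; rewrite -(ler_nat R) => h1; apply: le_trans h1 _.
case/andP: mk_bounds => _.
rewrite /size_constant; have := wk_bound; have := wn; have := n1.
have : 0 <= m1 * n%:R by rewrite mulr_ge0.
have : 0 <= (c + 1) * n%:R by rewrite mulr_ge0 //; real_lra.
real_lra.
Qed.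

(** The right side involves the length of [U], the shorter text. Together with the upper bound for
    [S] it places both lengths within a constant factor of n. *)
Lemma pattern_length_ge : n%:R <= (6 * (m0 * k0))^-1 * (3 * q * (2 * L * k))%:R.
Proof.
case: length_bounds => _ _ _ h1 _; rewrite -(ler_nat R) in h1.
have p : 0 < 6 * (m0 * k0) by rewrite !mulr_gt0.
rewrite mulrC ler_pdivlMr //; apply: le_trans h1; rewrite natrM.
by case/andP: mk_bounds => h1 _; real_lra.
Qed.

Lemma address_room : exists2 X : nat, X%:R <= size_constant * n%:R &
  [/\ ((n + w.-1) %/ w + k * ((m + w.-1) %/ w) + (m + q) + q + 2 <= X)%N,
      (n + q + 2 <= X)%N & (3 * q * ((n %/ q).+1 + 2 * L * k) <= X)%N].
Proof.
have w0 : (0 < w)%N by apply: leq_trans qw; exact: chunk_pos.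
exists (maxn (n + w + (m * k + w * k) + m + 2 * w + 2)
             (3 * q * ((n %/ q).+1 + 2 * L * k))).
  rewrite /maxn; case: ifP => _; first exact: text_length_le.
  case/andP: mk_bounds => _.
  have := wk_bound; have := wn; have := mn; have := n1.
  have : 0 <= m1 * k1 * n%:R by rewrite !mulr_ge0.
  have : 0 <= (c + 1) * k1 * n%:R by rewrite !mulr_ge0 //; real_lra.
  have : 0 <= (c + 1) * n%:R by rewrite mulr_ge0 //; real_lra.
  rewrite /size_constant; real_lra.
split; last exact: leq_maxr; apply: leq_trans (leq_maxl _ _).
  by apply: address_count_le => //; exact: cells_bound.
by move: qw; move: (q) => q'; clear; lia.
Qed.

(** This uses c >= 2: w' is at least 2 log n minus a constant, so a region has Omega(n ^ 2) cells,
    which exceeds any linear bound for large n. *)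
Lemma address_bound X : X%:R <= size_constant * n%:R ->
  log2 size_constant + e%:R + 6 * h%:R < l -> (X < 2 ^ w')%N.
Proof.
move=> hX hl; rewrite -(ltr_nat R) natrX.
have C0 : 0 < size_constant.
  rewrite /size_constant; have : 0 <= m1 * k1 by rewrite mulr_ge0.
  have := m1_ge0.
  have : 0 <= (c + 1) * k1 by rewrite mulr_ge0 //; real_lra.
  real_lra.
have Cn0 : 0 < size_constant * n%:R by apply: mulr_gt0 => //; have := n1; real_lra.
apply: le_lt_trans hX _; apply: ltr_log2; first by rewrite exprn_gt0.
rewrite log2Xn log2M ?ltr0n //.
case: q_bounds => _ _; rewrite -(ler_nat R) => h1 _.
have [a b] := ww_bounds.
have -> : w' = (3 * (h * q))%N by rewrite /w' mulnCA.
have cl : 2 * l <= c * l by rewrite ler_pM2r // l0.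
rewrite lE; real_lra.
Qed.

(** The simulated word is at most 6h bits shorter than w, and log N is within log C of log n; the
    slack e' absorbs both. *)
Lemma word_size_transfer (C N e' : nat) : (0 < C)%N ->
  (n <= C * N)%N -> (N <= C * n)%N ->
  e%:R + 6 * h%:R + c * log2 C%:R <= e'%:R -> word_size c e' N w'.
Proof.
move=> C0 h1 h2 he; have N0 : (0 < N)%N by case: N h1 {h2} => //; rewrite muln0 leqNgt n0.
have Cr : 0 < C%:R :> R by rewrite ltr0n.
have Nr : 0 < N%:R :> R by rewrite ltr0n.
have nr : 0 < n%:R :> R by rewrite ltr0n.
have g1 : l <= log2 C%:R + log2 N%:R.
  by rewrite -lE -log2M //; apply: ler_log2 => //; rewrite -natrM ler_nat.
have g2 : log2 N%:R <= log2 C%:R + l.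
  by rewrite -lE -log2M //; apply: ler_log2 => //; rewrite -natrM ler_nat.
case: q_bounds => _; rewrite -!(ler_nat R) => h3 h4 _.
rewrite /word_size ler_norml; have [a b] := ww_bounds.
have -> : w' = (3 * (h * q))%N by rewrite /w' mulnCA.
have g3 : c * l <= c * (log2 C%:R + log2 N%:R) by rewrite ler_pM2l //; real_lra.
have g4 : c * log2 N%:R <= c * (log2 C%:R + l) by rewrite ler_pM2l //; real_lra.
have h00 := @ler0n R h.
by apply/andP; split; real_lra.
Qed.

Definition time_constant : R :=
  80 / k0 + 100 * (6 * h%:R / k0 + 1) + 1000 * (6 * h%:R * m1 + 2) + 180.

(** All work outside the simulated programs is O(n / log n) = O(k): the table has at most sqrt n
    entries, the text has O(n / log n) chunks, and each pattern has O(1) chunks because m = O(log n)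
    while q is at least a constant fraction of log n. *)
Lemma construction_time :
  (20 * 2 ^ q + 100 * (n %/ q).+1 + 500 * L * k.+1 + 40 * k + 140)%:R
  <= time_constant * k%:R.
Proof.
have kk : 1 <= k%:R :> R by rewrite ler1n count_pos.
have nlk : n%:R / l <= k%:R / k0.
  by rewrite ler_pdivlMr // mulrC; case/andP: kb.
case: q_bounds => q0 h1 h2 h3; have qr : 0 < q%:R :> R by rewrite ltr0n.
have lq : l <= 6 * (h%:R * q%:R).
  case/andP: w_bounds => a _; apply: le_trans a _.
  by rewrite -natrM -(natrM R 6%N) ler_nat.
have hqr : 3 * (h%:R * q%:R) <= (c + 1) * l :> R.
  case/andP: w_bounds => _; apply: le_trans.
  by rewrite -natrM -(natrM R 3%N) ler_nat.
have c1 : 0 < c + 1 by real_lra.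
have q2 : 2 * q%:R <= l :> R.
  rewrite -(ler_pM2l c1); have : 2 * (c + 1) * q%:R <= 3 * h%:R * q%:R.
    by rewrite ler_wpM2r // ltW.
  by lra.
have p2 : (2 ^ q)%:R <= 4 * (n%:R / l).
  have ps : (2 ^ q)%:R <= s.
    rewrite -(@ler_pXn2r _ 2) // ?nnegrE ?(le_trans ler01 s1) //.
    rewrite expr2 -natrM -expnD (expr2 s) sE natrX; apply: log2_le_inv.
    - by rewrite exprn_gt0.
    - by rewrite ltr0n.
    - by rewrite log2Xn lE natrD; lra.
  apply: le_trans ps _; rewrite mulrA ler_pdivlMr // -sE.
  have := ls; have := s1; nra.
have [m_le L_le n_le _ _] := length_bounds.
have dq : (n %/ q)%:R <= 6 * h%:R * (n%:R / l).
  rewrite -(ler_pM2r qr); apply: (@le_trans _ _ n%:R); first by rewrite -natrM ler_nat.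
  have : n%:R / l * l <= n%:R / l * (6 * (h%:R * q%:R)) by rewrite ler_pM2l.
  by rewrite nlE; lra.
set L1 := 6 * h%:R * m1 + 2.
have Lb : L%:R <= L1.
  rewrite -(ler_pM2r qr) mulrC -natrM.
  have g1 : (q * L)%:R <= m%:R + 2 * q%:R :> R by rewrite -(natrM R 2%N) -natrD ler_nat.
  have g2 : m1 * l <= m1 * (6 * (h%:R * q%:R)) by rewrite ler_wpM2l.
  by case/andP: mb => _ g3; rewrite /L1; lra.
have L10 : 0 <= L1 by apply: le_trans Lb; exact: ler0n.
have f3 : L%:R * k.+1%:R <= L1 * (2 * k%:R).
  by rewrite ler_pM // -natr1; lra.
have f2 : h%:R * (n%:R / l) <= h%:R * (k%:R / k0) by rewrite ler_wpM2l.
have -> : time_constant * k%:R = 80 * (k%:R / k0) + 100 * (6 * (h%:R * (k%:R / k0)) + k%:R)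
    + 1000 * (L1 * k%:R) + 180 * k%:R.
  by rewrite /time_constant -/L1; ring.
have -> : (20 * 2 ^ q + 100 * (n %/ q).+1 + 500 * L * k.+1 + 40 * k + 140)%:R =
    20 * (2 ^ q)%:R + 100 * ((n %/ q)%:R + 1) + 500 * (L%:R * k.+1%:R) + 40 * k%:R + 140 :> R.
  by move: (2 ^ q)%N (n %/ q)%N (L) => x y z; ring.
lra.
Qed.

End Bounds.

(** The bound [t] in [dm_solves] may depend on n only, while the text lengths depend on w through q,
    and P and Q need not be monotone. The maximum covers all lengths within a factor C of n. *)
Definition range_max (C : nat) (P : nat -> nat) (n : nat) : nat :=
  (\max_(N < (C * n).+1 | n <= C * N) P N)%N.

Lemma range_max_ge C P n N : (n <= C * N)%N -> (N <= C * n)%N ->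
  (P N <= range_max C P n)%N.
Proof.
move=> h1 h2; rewrite -ltnS in h2.
exact: (@leq_bigmax_cond _ (fun N : 'I__ => n <= C * N)%N (fun N : 'I__ => P N) (Ordinal h2)).
Qed.

Section Asymptotics.
Context {R : realType}.
Implicit Types (f g : nat -> R) (x y : R).

Lemma range_max_le C P n x : 0 <= x ->
  (forall N, (n <= C * N)%N -> (N <= C * n)%N -> (P N)%:R <= x) ->
  (range_max C P n)%:R <= x.
Proof.
move=> x0 h; rewrite /range_max; elim/big_ind: _ => // [a b ha hb|N hN].
  by rewrite /maxn; case: ifP.
by apply: h => //; rewrite -ltnS.
Qed.

Lemma theta_bounds f g : f =Theta_\oo g ->
  exists2 ab : R * R, 0 < ab.1 /\ 0 < ab.2 &
    \forall n \near \oo, ab.1 * `|g n| <= `|f n| <= ab.2 * `|g n|.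
Proof.
rewrite eqThetaE qualifE => /asboolP [[a b] /andP [a0 b0] h]; exists (a, b) => //.
by near=> n; apply/andP; near: n.
Unshelve. all: by end_near. Qed.

Lemma sqrt_le_double x y : 0 <= y -> x <= 4 * y -> Num.sqrt x <= 2 * Num.sqrt y.
Proof.
move=> y0 xy; have -> : 2 * Num.sqrt y = Num.sqrt (4 * y).
  rewrite sqrtrM //; congr (_ * _); rewrite -[LHS]ger0_norm // -sqrtr_sqr.
  by congr Num.sqrt; ring.
by apply: ler_wsqrtr.
Qed.

(** The additive error log C is at most 3/4 of log n, so log N is at least a quarter of log n. *)
Lemma log2_range (C n N : nat) : (0 < C)%N -> (0 < n)%N ->
  (n <= C * N)%N -> (N <= C * n)%N -> log2 (C%:R : R) <= 3 / 4 * log2 n%:R ->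
  log2 (n%:R : R) <= 4 * log2 N%:R /\ log2 (N%:R : R) <= 4 * log2 n%:R.
Proof.
move=> C0 n0 h1 h2 hC; have N0 : (0 < N)%N.
  by case: N h1 {h2} => //; rewrite muln0 leqNgt n0.
have Cr : 0 < C%:R :> R by rewrite ltr0n.
have Nr : 0 < N%:R :> R by rewrite ltr0n.
have nr : 0 < n%:R :> R by rewrite ltr0n.
have g1 : log2 n%:R <= log2 C%:R + log2 N%:R :> R.
  by rewrite -log2M //; apply: ler_log2 => //; rewrite -natrM ler_nat.
have g2 : log2 N%:R <= log2 C%:R + log2 n%:R :> R.
  by rewrite -log2M //; apply: ler_log2 => //; rewrite -natrM ler_nat.
have l0 : 0 <= log2 n%:R :> R by apply: log2_ge0; rewrite ler1n.
by split; lra.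
Qed.

Lemma range_max_div_o (C : nat) P : (0 < C)%N ->
  (fun N => (P N)%:R : R) =o_\oo (fun N => N%:R / Num.sqrt (log2 N%:R) : R) ->
  forall eps : R, 0 < eps -> \forall n \near \oo,
    (range_max C P n)%:R <= eps * (n%:R / Num.sqrt (log2 n%:R)).
Proof.
move=> C0 /eqoP hP eps e0.
have Cr : 0 < C%:R :> R by rewrite ltr0n.
(* The factor C is lost in N <= C n and the factor 2 in sqrt(log n) <= 2 sqrt(log N). *)
have [N0 _ hN] := hP (eps / (2 * C%:R)) ltac:(by apply: divr_gt0 => //; apply: mulr_gt0).
near=> n.
have n0 : (0 < n)%N by near: n; exact: nbhs_infty_gt.
have nN : (C * N0 < n)%N by near: n; exact: nbhs_infty_gt.
have l1 : 1 <= log2 (n%:R : R) by near: n; exact: log2_near.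
have lC : 4 / 3 * log2 (C%:R : R) <= log2 n%:R by near: n; exact: log2_near.
have s0 : 0 < Num.sqrt (log2 (n%:R : R)) by rewrite sqrtr_gt0; lra.
apply: range_max_le => [|N h1 h2].
  by apply: mulr_ge0; [exact: ltW|rewrite divr_ge0 // ltW].
have NN0 : (N0 <= N)%N by rewrite -(leq_pmul2l C0); lia.
have [g1 g2] : log2 (n%:R : R) <= 4 * log2 N%:R /\ log2 (N%:R : R) <= 4 * log2 n%:R.
  by apply: (log2_range C0) => //; lra.
have := hN N NN0; rewrite /= normr_nat => hP1; apply: le_trans hP1 _.
rewrite ger0_norm ?divr_ge0 ?sqrtr_ge0 //.
have sN : Num.sqrt (log2 (n%:R : R)) <= 2 * Num.sqrt (log2 N%:R).
  by apply: sqrt_le_double => //; lra.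
have sN0 : 0 < Num.sqrt (log2 (N%:R : R)) by lra.
rewrite -mulrA ler_pM2l //.
have -> : (2 * C%:R)^-1 * (N%:R / Num.sqrt (log2 N%:R)) =
   (N%:R / C%:R) * (2 * Num.sqrt (log2 N%:R))^-1 :> R by rewrite !invfM; ring.
rewrite ler_pM ?divr_ge0 ?invr_ge0 ?mulr_ge0 ?sqrtr_ge0 //.
  by rewrite ler_pdivrMr // mulrC -natrM ler_nat.
by rewrite lef_pV2 ?posrE ?mulr_gt0.
Unshelve. all: by end_near. Qed.

Lemma range_max_sqrt_o (C : nat) Q : (0 < C)%N ->
  (fun N => (Q N)%:R : R) =o_\oo (fun N => Num.sqrt (log2 N%:R) : R) ->
  forall eps : R, 0 < eps -> \forall n \near \oo,
    (range_max C Q n)%:R <= eps * Num.sqrt (log2 n%:R).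
Proof.
move=> C0 /eqoP hQ eps e0.
have Cr : 0 < C%:R :> R by rewrite ltr0n.
have [N0 _ hN] := hQ (eps / 2) ltac:(by apply: divr_gt0).
near=> n.
have n0 : (0 < n)%N by near: n; exact: nbhs_infty_gt.
have nN : (C * N0 < n)%N by near: n; exact: nbhs_infty_gt.
have l1 : 1 <= log2 (n%:R : R) by near: n; exact: log2_near.
have lC : 4 / 3 * log2 (C%:R : R) <= log2 n%:R by near: n; exact: log2_near.
apply: range_max_le => [|N h1 h2].
  by rewrite mulr_ge0 ?sqrtr_ge0 ?ltW.
have NN0 : (N0 <= N)%N by rewrite -(leq_pmul2l C0); lia.
have [g1 g2] : log2 (n%:R : R) <= 4 * log2 N%:R /\ log2 (N%:R : R) <= 4 * log2 n%:R.
  by apply: (log2_range C0) => //; lra.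
have := hN N NN0; rewrite /= normr_nat => hQ1; apply: le_trans hQ1 _.
rewrite ger0_norm ?sqrtr_ge0 // -mulrA ler_pM2l // ler_pdivrMl //.
by apply: sqrt_le_double => //; lra.
Unshelve. all: by end_near. Qed.

End Asymptotics.

Lemma dm_fast_reduction (R : realType) (c : R) (X : isa_structure) (P Q : nat -> nat)
    (h : nat) :
  2 <= c -> (0 < h)%N -> 2 * (c + 1) <= 3 * h%:R -> isa_solves c X P Q ->
  (fun N => (P N)%:R : R) =o_\oo (fun N => N%:R / Num.sqrt (log2 N%:R) : R) ->
  (fun N => (Q N)%:R : R) =o_\oo (fun N => Num.sqrt (log2 N%:R) : R) ->
  dm_fast c (reduction h X).
Proof.
move=> c2 h0 hh solX oP oQ k m thk thm.
have [[k0 k1] /= [k00 k10] kb] := theta_bounds thk.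
have [[m0 m1] /= [m00 m10] mb] := theta_bounds thm.
have [C1 hC1] := nat_above (size_constant c k1 m1).
have [C2 hC2] := nat_above (6 * (m0 * k0))^-1.
pose C := (maxn C1 C2).+1.
have C0 : (0 < C)%N by [].
have CC1 : size_constant c k1 m1 <= C%:R.
  by apply: le_trans hC1 _; rewrite ler_nat leqW // leq_maxl.
have CC2 : (6 * (m0 * k0))^-1 <= C%:R.
  by apply: le_trans hC2 _; rewrite ler_nat leqW // leq_maxr.
have [K hK] := nat_above (time_constant k0 m1 h).
(* Two simulated preprocessings at 3 steps per step give 6, and four queries per pattern give 12. *)
pose t n := (K * k n + 6 * range_max C P n + 12 * (k n * range_max C Q n))%N.
exists t.
- apply/eqoP => eps e0 /=.
  (* Each of the three terms of [t] gets a third of eps: 6 times eps / 18, 12 k1 times eps / (36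
     k1), and the term in K for n large. *)
  have e3 : 0 < eps / 18 by lra.
  have e36 : 0 < eps / (36 * k1) by rewrite divr_gt0 // mulr_gt0.
  near=> n.
  have l1 : 1 <= log2 (n%:R : R) by near: n; exact: log2_near.
  have lbig : (3 * (K%:R * k1) / eps) ^+ 2 <= log2 (n%:R : R) by near: n; exact: log2_near.
  have pP : (range_max C P n)%:R <= eps / 18 * (n%:R / Num.sqrt (log2 (n%:R : R))).
    by near: n; exact: range_max_div_o.
  have pQ : (range_max C Q n)%:R <= eps / (36 * k1) * Num.sqrt (log2 (n%:R : R)).
    by near: n; exact: range_max_sqrt_o.
  have kn : k0 * `|n%:R / log2 n%:R : R| <= `|(k n)%:R : R| <= k1 * `|n%:R / log2 n%:R|.
    by near: n.
  set r := Num.sqrt (log2 (n%:R : R)) in pP pQ *.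
  have l0 : 0 <= log2 (n%:R : R) by lra.
  have r0 : 0 < r by rewrite sqrtr_gt0; lra.
  have rr : r * r = log2 n%:R by rewrite -expr2 sqr_sqrtr.
  have y0 : 0 <= n%:R / r :> R by rewrite divr_ge0 // ltW.
  have rbig : 3 * (K%:R * k1) / eps <= r.
    rewrite -(@ler_pXn2r _ 2) ?nnegrE ?(ltW r0) //; first by rewrite expr2 (expr2 r) rr -expr2.
    by rewrite divr_ge0 ?mulr_ge0 // ltW.
  have nl0 : 0 <= n%:R / log2 n%:R :> R by rewrite divr_ge0.
  case/andP: kn => _; rewrite (ger0_norm nl0) normr_nat => kn.
  rewrite normr_nat (ger0_norm y0).
  rewrite ler_pdivrMr // in rbig.
  (* As r * r = log n, a factor sqrt(log n) on each of the k queries turns n / log n into n /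
     sqrt(log n). *)
  have kr : (k n)%:R * r <= k1 * (n%:R / r) :> R.
    have -> : k1 * (n%:R / r) = k1 * (n%:R / log2 n%:R) * r.
      by rewrite -rr invfM; field; rewrite gt_eqF.
    by rewrite ler_pM2r.
  have kK : K%:R * (k n)%:R <= eps / 3 * (n%:R / r) :> R.
    have g1 : K%:R * ((k n)%:R * r) <= K%:R * (k1 * (n%:R / r)) by rewrite ler_wpM2l.
    have g2 : 3 * (K%:R * k1) * (n%:R / r) <= r * eps * (n%:R / r) by rewrite ler_wpM2r.
    by rewrite -(ler_pM2r r0); lra.
  have kQ : (k n)%:R * (range_max C Q n)%:R <= eps / 36 * (n%:R / r) :> R.
    have g1 : (k n)%:R * (range_max C Q n)%:R <= (k n)%:R * (eps / (36 * k1) * r) :> R.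
      by rewrite ler_wpM2l.
    apply: le_trans g1 _.
    have -> : (k n)%:R * (eps / (36 * k1) * r) = eps / (36 * k1) * ((k n)%:R * r) by ring.
    apply: (@le_trans _ _ (eps / (36 * k1) * (k1 * (n%:R / r)))).
      by rewrite ler_wpM2l // ltW.
    by rewrite le_eqVlt; apply/orP; left; apply/eqP; field; rewrite !gt_eqF.
  by rewrite /t !natrD !natrM; lra.
- move=> e.
  have [e' he'] := nat_above (e%:R + 6 * h%:R + c * log2 (C%:R : R)).
  have [N1 _ solN] := solX e'.
  near=> n; move=> w ww T D.
  have n0 : (0 < n)%N by near: n; exact: nbhs_infty_gt.
  have nN : (C * N1 < n)%N by near: n; exact: nbhs_infty_gt.
  have l1 : 1 <= log2 (n%:R : R) by near: n; exact: log2_near.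
  have le_l : e%:R <= log2 (n%:R : R) by near: n; exact: log2_near.
  have lh : 12 * h%:R <= log2 (n%:R : R) by near: n; exact: log2_near.
  have lsize : log2 (size_constant c k1 m1) + e%:R + 6 * h%:R + 1 <= log2 (n%:R : R).
    by near: n; exact: log2_near.
  have kn : k0 * `|n%:R / log2 n%:R : R| <= `|(k n)%:R : R| <= k1 * `|n%:R / log2 n%:R|.
    by near: n.
  have mn : m0 * `|log2 n%:R : R| <= `|(m n)%:R : R| <= m1 * `|log2 n%:R| by near: n.
  set l := log2 (n%:R : R) in l1 le_l lh lsize kn mn.
  have l0 : 0 <= l by lra.
  have nl0 : 0 <= n%:R / l by rewrite divr_ge0.
  rewrite (ger0_norm nl0) normr_nat in kn; rewrite (ger0_norm l0) normr_nat in mn.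
  have {}lsize : log2 (size_constant c k1 m1) + e%:R + 6 * h%:R < l by lra.
  have q0 := chunk_pos c2 k00 m00 h0 hh (erefl l) l1 le_l lh ww.
  have kpos := count_pos k00 n0 l1 kn.
  have mpos := length_pos m00 l1 mn.
  have tle := text_length_le c2 k00 m00 h0 hh n0 (erefl l) l1 le_l lh ww kn mn erefl.
  have pge := pattern_length_ge c2 k00 m00 h0 hh n0 (erefl l) l1 le_l lh ww kn mn.
  have [Y Yle [a1 a2 a3]] :=
    address_room c2 k00 m00 h0 hh n0 (erefl l) l1 le_l lh ww kn mn erefl.
  have Yw := address_bound c2 k00 m00 h0 hh n0 (erefl l) l1 le_l lh ww kn mn Yle lsize.
  have ct := construction_time c2 k00 m00 h0 hh n0 (erefl l) l1 le_l lh ww kn mn erefl.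
  have transfer := word_size_transfer c2 k00 m00 h0 hh n0 (erefl l) l1 le_l lh ww C0 _ _ he'.
  move eq : (w %/ (3 * h) - 1)%N q0 tle pge a1 a2 a3 Yw ct transfer => q q0 tle pge a1 a2 a3
    Yw ct transfer.
  set U := pattern_blocks q (m n + q) [seq tval p | p <- D].
  set S := padded q n true T ++ U.
  have szU : size U = (3 * q * (2 * ((m n + q) %/ q).+1 * k n))%N.
    rewrite size_pattern_blocks // ?size_map ?size_tuple //.
    by apply/allP => x /mapP [p _ ->]; rewrite size_tuple leq_addr.
  have szS : size S = (3 * q * ((n %/ q).+1 + 2 * ((m n + q) %/ q).+1 * k n))%N.
    by rewrite (size_cat (padded q n true T)) szU size_padded ?size_tuple // -mulnDr.
  have US : (size U <= size S)%N by rewrite (size_cat (padded q n true T)) leq_addl.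
  have SC : (size S <= C * n)%N.
    rewrite szS -(ler_nat R); apply: le_trans tle _; rewrite natrM.
    by rewrite ler_wpM2r.
  have UC : (n <= C * size U)%N.
    rewrite szU -(ler_nat R) (natrM R C); apply: le_trans pge _.
    by rewrite ler_wpM2r.
  (* Both lengths are within a factor C of n, so the guarantee applies with words of w' bits, and
     the range maxima bound its costs. *)
  have run V : (n <= C * size V)%N -> (size V <= C * n)%N ->
      isa_run (h * (3 * q)) X V (range_max C P n) (range_max C Q n).
    move=> h1 h2.
    have N1V : (N1 <= size V)%N by rewrite -(leq_pmul2l C0); exact: leq_trans (ltnW nN) h1.
    have [tr0 [s0 [x0 t0 ok]]] := solN _ N1V _ (transfer _ h1 h2) (in_tuple V).
    exists tr0, s0; split=> //; first by apply: leq_trans t0 _; exact: range_max_ge.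
    move=> s j aq hj; have [tr [s' [x1 r1 t1]]] := ok s j aq hj.
    by exists tr, s'; split=> //; apply: leq_trans t1 _; exact: range_max_ge.
  have [tr [s' [x ans tb]]] := reduction_correct (esym eq) h0 q0 mpos kpos
    (leq_ltn_trans a1 Yw) (leq_ltn_trans a2 Yw) (leq_ltn_trans a3 Yw)
    (run S (leq_trans UC (leq_mul (leqnn C) US)) SC)
    (run U UC (leq_trans US SC)).
  exists tr, s'; split=> //; apply: leq_trans tb _.
  have ctN : (20 * 2 ^ q + 100 * (n %/ q).+1 + 500 * ((m n + q) %/ q).+1 * (k n).+1
      + 40 * k n + 140 <= K * k n)%N.
    rewrite -(ler_nat R); apply: le_trans ct _; rewrite natrM.
    by rewrite ler_wpM2r.
  rewrite /t; move: ctN.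
  move: (range_max C P n) (range_max C Q n) (2 ^ q)%N (n %/ q)%N ((m n + q) %/ q)%N (k n).
  by clear; move=> p1 q1 x y z kk; lia.
Unshelve. all: by end_near. Qed.

Lemma bigO1_little_o_sqrt_log2 (R : realType) (Q : nat -> nat) :
  (fun N => (Q N)%:R : R) =O_\oo (fun _ => 1 : R) ->
  (fun N => (Q N)%:R : R) =o_\oo (fun N => Num.sqrt (log2 N%:R) : R).
Proof.
move=> /eqO_exP [a a0 hQ]; apply/eqoP => eps e0; near=> n.
have Qa : `|(Q n)%:R : R| <= a * `|1 : R| by near: n.
have big : (a / eps) ^+ 2 <= log2 (n%:R : R) by near: n; exact: log2_near.
rewrite normr1 mulr1 in Qa; apply: le_trans Qa _ => /=.
rewrite ger0_norm ?sqrtr_ge0 // -ler_pdivrMl // mulrC.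
have ae0 : 0 <= a / eps by rewrite divr_ge0 // ltW.
by rewrite -(ger0_norm ae0) -sqrtr_sqr; exact: ler_wsqrtr.
Unshelve. all: by end_near. Qed.

Theorem corollary8p3 (R : realType) (c : R) (c_ge2 : 2 <= c)
  (dm_hard : ~ exists A : program, dm_fast c A) :
  (forall (X : isa_structure) (P Q : nat -> nat), isa_solves c X P Q ->
     ~ ((fun N => (P N)%:R : R) =o_\oo (fun N => N%:R / Num.sqrt (log2 N%:R) : R)
        /\ (fun N => (Q N)%:R : R) =o_\oo (fun N => Num.sqrt (log2 N%:R) : R)))
  /\
  (forall (X : isa_structure) (P Q B PS : nat -> nat),
     isa_solves c X P Q -> isa_space c X B PS ->
     (fun N => (B N)%:R : R) =O_\oo (fun N => N%:R : R) ->
     (fun N => (P N)%:R : R) =O_\oo (fun N => N%:R / Num.sqrt (log2 N%:R) : R) ->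
     (fun N => (PS N)%:R : R) =O_\oo (fun N => N%:R : R) ->
     (fun N => (Q N)%:R : R) =O_\oo (fun _ => 1 : R) ->
     ~ (fun N => (P N)%:R : R) =o_\oo (fun N => N%:R / Num.sqrt (log2 N%:R) : R)).
Proof.
have main X P Q : isa_solves c X P Q ->
    ~ ((fun N => (P N)%:R : R) =o_\oo (fun N => N%:R / Num.sqrt (log2 N%:R) : R)
       /\ (fun N => (Q N)%:R : R) =o_\oo (fun N => Num.sqrt (log2 N%:R) : R)).
  (* With c >= 2, any h >= c + 1 is positive and satisfies 3h >= 2(c + 1). *)
  move=> sol [oP oQ]; have [h ch] := nat_above (c + 1); apply: dm_hard.
  have h0 : (0 < h)%N by rewrite -(ltr0n R); lra.
  have hh : 2 * (c + 1) <= 3 * h%:R by lra.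
  by exists (reduction h X); exact: dm_fast_reduction sol oP oQ.
(* Constant query time is o(sqrt(log N)), so the second claim is an instance of the first. *)
split=> // X P Q B PS sol _ _ _ _ OQ oP; apply: main sol _; split=> //.
exact: bigO1_little_o_sqrt_log2.
Qed.
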